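(* Let $G$ be a metabelian group with an abelian normal subgroup $A \le G$ such that the quotient group $B = G/A$ is finitely generated abelian. Let $t(A)$ be the torsion subgroup of $A$. Suppose that the quotient group $G/t(A)$ has Krull dimension and has no $\mathbb{Z}\wr\mathbb{Z}$-sections. Then the quotient group $G/t(A)$ is minimax and $K(G/t(A)) \le 1$.
   Context: A group is minimax if it has a finite subnormal series each of whose factors satisfies either the minimal or the maximal condition on subgroups. Deviation of a poset $\Omega$: for $a\ge b$ in $\Omega$ put $a/b=\{x\in\Omega \mid b\le x\le a\}$. If $\Omega$ is trivial (no two distinct elements are comparable), $\operatorname{dev}\Omega=-1$. If $\Omega$ is nontrivial and satisfies the minimal condition, $\operatorname{dev}\Omega=0$. For a general ordinal $\beta$, $\operatorname{dev}\Omega=\beta$ if $\operatorname{dev}\Omega\neq\alpha$ for all $\alpha<\beta$ and, in any descending chain $\{a_i\}$ of elements of $\Omega$, all but finitely many factors $a_i/a_{i+1}$ have deviation less than $\beta$. (The deviation need not exist.) The Krull dimension $K(G)$ of a group $G$ is the deviation of the poset of all normal subgroups of $G$ ordered by inclusion, if it exists. $\mathbb{Z}\wr\mathbb{Z}$ is the restricted wreath product of two infinite cyclic groups. A group $\Gamma$ has no $\mathbb{Z}\wr\mathbb{Z}$-sections if there are no subgroups $K\trianglelefteq H\le \Gamma$ with $H/K\cong\mathbb{Z}\wr\mathbb{Z}$. *)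

(* Defs.v *)
From HB Require Import structures.
From mathcomp Require Import all_boot all_order ssralg ssrint generic_quotient.
From mathcomp Require Import boolp classical_sets functions cardinality.

Set Implicit Arguments.
Unset Strict Implicit.
Unset Printing Implicit Defensive.

Import Order.TTheory.

Local Open Scope classical_set_scope.
Local Open Scope group_scope.
Local Open Scope quotient_scope.

(** * Subgroups and quotients of arbitrary (possibly infinite) groups *)

Definition is_subgroup (G : groupType) (H : set G) : Prop :=
  H 1 /\ forall x y, H x -> H y -> H (x / y).

Definition is_normal_subgroup (G : groupType) (N : set G) : Prop :=
  is_subgroup N /\ forall x y, N x -> N (x ^ y).

Definition subgroups (G : groupType) : set (set G) := @is_subgroup G.
Definition normal_subgroups (G : groupType) : set (set G) :=
  @is_normal_subgroup G.
Arguments subgroups : clear implicits.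
Arguments normal_subgroups : clear implicits.

Record subgroup (G : groupType) :=
  Subgroup { subgroup_set :> set G; subgroupP : is_subgroup subgroup_set }.

Record normal_subgroup (G : groupType) := NormalSubgroup {
  normal_subgroup_set :> set G;
  normal_subgroupP : is_normal_subgroup normal_subgroup_set
}.

Definition group_of (G : groupType) (H : subgroup G) : Type :=
  set_type (subgroup_set H).

Section GroupOf.
Variables (G : groupType) (H : subgroup G).

Lemma subgroup_closed : group_closed [pred x | x \in subgroup_set H].
Proof.
have [H1 HF] := subgroupP H; split; first by rewrite !inE.
by move=> x y; rewrite !inE; exact: HF.
Qed.

HB.instance Definition _ := SubChoice.on (group_of H).
HB.instance Definition _ :=
  SubChoice_isSubGroup.Build G _ (group_of H) subgroup_closed.

End GroupOf.

Section Quotient.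
Variables (G : groupType) (N : normal_subgroup G).

Definition coset_rel (x y : G) : bool := `[< (N : set G) (x^-1 * y) >].

Lemma coset_rel_refl : reflexive coset_rel.
Proof. by move=> x; apply/asboolP; rewrite mulVg; case: N => ? [[]]. Qed.

Lemma normal_subgroupV x : (N : set G) x -> (N : set G) x^-1.
Proof.
by case: N => S [[S1 SF] _] /= Sx; rewrite -[x^-1]mul1g; apply: SF.
Qed.

Lemma normal_subgroupM x y : (N : set G) x -> (N : set G) y -> (N : set G) (x * y).
Proof.
move=> Nx /normal_subgroupV; case: N Nx => S [[S1 SF] _] /= Sx Sy.
by rewrite -[y]invgK; apply: SF.
Qed.

Lemma normal_subgroupJ x y : (N : set G) x -> (N : set G) (x ^ y).
Proof. by case: N => S [_ SJ] /=; apply: SJ. Qed.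

Lemma coset_rel_sym : symmetric coset_rel.
Proof.
move=> x y; apply: asbool_equiv_eq.
by split=> /normal_subgroupV; rewrite invgM invgK.
Qed.

Lemma coset_rel_trans : transitive coset_rel.
Proof.
move=> y x z /asboolP Nxy /asboolP Nyz; apply/asboolP.
by rewrite -[z](mulVKg y) mulgA; apply: normal_subgroupM.
Qed.

Canonical coset_equiv :=
  EquivRel coset_rel coset_rel_refl coset_rel_sym coset_rel_trans.

Definition quotient_group : Type := {eq_quot coset_equiv}.
HB.instance Definition _ := Choice.on quotient_group.
HB.instance Definition _ := EqQuotient.on quotient_group.

Definition quotient_proj (x : G) : quotient_group :=
  \pi_{eq_quot coset_equiv} x.

Definition quotient_one : quotient_group := quotient_proj 1.
Definition quotient_inv (a : quotient_group) : quotient_group :=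
  quotient_proj (repr a)^-1.
Definition quotient_mul (a b : quotient_group) : quotient_group :=
  quotient_proj (repr a * repr b).

Lemma quotient_projP (a : quotient_group) : exists x, a = quotient_proj x.
Proof. by exists (repr a); rewrite /quotient_proj reprK. Qed.

Lemma quotient_eqP (x y : G) :
  (quotient_proj x = quotient_proj y) <-> (N : set G) (x^-1 * y).
Proof.
split; first by move/eqmodP/asboolP.
by move=> Nxy; apply/eqmodP/asboolP.
Qed.

Lemma repr_quotient_proj (x : G) :
  (N : set G) (x^-1 * repr (quotient_proj x)).
Proof. by apply/quotient_eqP; rewrite /quotient_proj reprK. Qed.

Lemma quotient_invE (x : G) :
  quotient_inv (quotient_proj x) = quotient_proj x^-1.
Proof.
apply/quotient_eqP; rewrite invgK.
have /(@normal_subgroupJ _ x^-1) := repr_quotient_proj x.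
by rewrite /conjg invgK -mulgA mulVKg.
Qed.

Lemma quotient_mulE (x y : G) :
  quotient_mul (quotient_proj x) (quotient_proj y) = quotient_proj (x * y).
Proof.
apply/esym/quotient_eqP.
have := repr_quotient_proj x; move: (repr (quotient_proj x)) => x' Nx.
have := repr_quotient_proj y; move: (repr (quotient_proj y)) => y' Ny.
rewrite (_ : _ * _ = ((x^-1 * x') ^ y) * (y^-1 * y')).
  by apply: normal_subgroupM => //; apply: normal_subgroupJ.
by rewrite /conjg invgM !mulgA mulgK.
Qed.

Lemma quotient_mulA : associative quotient_mul.
Proof.
move=> a b c; have [x ->] := quotient_projP a.
have [y ->] := quotient_projP b; have [z ->] := quotient_projP c.
rewrite (quotient_mulE x y) (quotient_mulE y z).
by rewrite (quotient_mulE x) (quotient_mulE _ z) mulgA.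
Qed.

Lemma quotient_mul1 : left_id quotient_one quotient_mul.
Proof.
by move=> a; have [x ->] := quotient_projP a; rewrite (quotient_mulE 1) mul1g.
Qed.

Lemma quotient_mulr1 : right_id quotient_one quotient_mul.
Proof.
by move=> a; have [x ->] := quotient_projP a; rewrite (quotient_mulE x) mulg1.
Qed.

Lemma quotient_mulV : left_inverse quotient_one quotient_inv quotient_mul.
Proof.
move=> a; have [x ->] := quotient_projP a.
by rewrite (quotient_invE x) (quotient_mulE _ x) mulVg.
Qed.

Lemma quotient_mulrV : right_inverse quotient_one quotient_inv quotient_mul.
Proof.
move=> a; have [x ->] := quotient_projP a.
by rewrite (quotient_invE x) (quotient_mulE x) mulgV.
Qed.

HB.instance Definition _ := isGroup.Build quotient_group
  quotient_mulA quotient_mul1 quotient_mulr1 quotient_mulV quotient_mulrV.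

Lemma quotient_projM : {morph quotient_proj : x y / x * y}.
Proof. by move=> x y; rewrite -[LHS]quotient_mulE. Qed.

HB.instance Definition _ :=
  isMultiplicative.Build G quotient_group quotient_proj quotient_projM.

End Quotient.

(** * Group-theoretic properties *)

Definition isomorphic (G H : groupType) : Prop :=
  exists f : {multiplicative G -> H}, bijective f.

Definition generated (G : groupType) (S : set G) : set G :=
  smallest (@is_subgroup G) S.

Definition finitely_generated (G : groupType) : Prop :=
  exists s : seq G, generated [set x | x \in s] = [set: G].

Definition abelian_set (G : groupType) (H : set G) : Prop :=
  forall x y, H x -> H y -> commute x y.

Definition abelian_group (G : groupType) : Prop := abelian_set [set: G].

Definition derived_subgroup (G : groupType) : set G :=
  generated [set z | exists x y : G, z = [~ x, y]].
Arguments derived_subgroup : clear implicits.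

Definition metabelian (G : groupType) : Prop :=
  abelian_set (derived_subgroup G).

Definition torsion_set (G : groupType) (A : set G) : set G :=
  [set a | A a /\ exists2 n : nat, (0 < n)%N & a ^+ n = 1].

Lemma torsion_set_normal (G : groupType) (A : normal_subgroup G) :
  abelian_set A -> is_normal_subgroup (torsion_set A).
Proof.
case: A => A [[A1 AF] AJ] /= abA; split; first split.
- by split=> //; exists 1%N.
- move=> x y [Ax [m m0 xm]] [Ay [n n0 yn]]; split; first exact: AF.
  exists (m * n)%N; first by rewrite muln_gt0 m0.
  have AV : A y^-1 by rewrite -[y^-1]mul1g; apply: AF.
  rewrite expgMn; last exact: abA.
  by rewrite expgnA xm expg1n mulnC expgnA expVgn yn invg1 expg1n mulg1.
- move=> x y [Ax [m m0 xm]]; split; first exact: AJ.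
  by exists m => //; rewrite -conjXg xm conj1g.
Qed.

(** The torsion subgroup of an abelian normal subgroup [A] of [G]. *)
Definition torsion_subgroup (G : groupType) (A : normal_subgroup G)
    (abA : abelian_set A) : normal_subgroup G :=
  NormalSubgroup (torsion_set_normal abA).

(** [G] has a section [H / K] isomorphic to [W]: the subgroups of [G] contained
    in [H] and normal in [H] are the normal subgroups of the group [H]. *)
Definition has_section (G W : groupType) : Prop :=
  exists (H : subgroup G) (K : normal_subgroup (group_of H)),
    isomorphic (quotient_group K) W.

(** * Chain conditions and minimax groups *)

Section Posets.
Variables (d : Order.disp_t) (T : porderType d).
Implicit Type W : set T.
Local Open Scope order_scope.

Definition min_condition W : Prop :=
  forall S, S `<=` W -> S !=set0 ->
    exists2 m, S m & forall x, S x -> x <= m -> x = m.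

Definition max_condition W : Prop :=
  forall S, S `<=` W -> S !=set0 ->
    exists2 m, S m & forall x, S x -> m <= x -> x = m.

Definition trivial_poset W : Prop :=
  forall x y, W x -> W y -> x <= y -> x = y.

Definition factor W (a b : T) : set T := [set x | W x /\ b <= x <= a].

Definition descending_chain W (a : nat -> T) : Prop :=
  forall n, W (a n) /\ a n.+1 <= a n.

End Posets.

Definition min_subgroups (G : groupType) : Prop := min_condition (subgroups G).
Definition max_subgroups (G : groupType) : Prop := max_condition (subgroups G).

(** [1 = S 0 <| S 1 <| ... <| S n = G]; [N] is the term [S i] seen as a normal
    subgroup of the group [S i.+1]. *)
Definition minimax (G : groupType) : Prop :=
  exists (n : nat) (S : nat -> subgroup G),
    [/\ subgroup_set (S 0%N) = [set 1],
        subgroup_set (S n) = [set: G]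
      & forall i, (i < n)%N ->
          exists N : normal_subgroup (group_of (S i.+1)),
            subgroup_set (S i) = [set val x | x in normal_subgroup_set N] /\
            (min_subgroups (quotient_group N) \/
             max_subgroups (quotient_group N))].

(** * Ordinals *)

(** [Osup X f] is the least ordinal strictly greater than every [f i]. An ordinal
    has many such representations: equality of ordinals is [ord_le] in both
    directions, not Leibniz equality. *)
Inductive ord : Type := Osup (X : Type) (f : X -> ord).
Arguments Osup : clear implicits.

Fixpoint ord_le (a b : ord) {struct a} : Prop :=
  match a, b with
  | Osup X f, Osup Y g => forall i : X, exists j : Y, ord_le (f i) (g j)
  end.

Definition ord_lt (a b : ord) : Prop :=
  match b with Osup Y g => exists j : Y, ord_le a (g j) end.

Definition Ozero : ord := Osup Empty_set (fun e : Empty_set => match e with end).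
Definition Oone : ord := Osup unit (fun _ : unit => Ozero).

Lemma ord_le_refl a : ord_le a a.
Proof. by elim: a => X f IH /= i; exists i. Qed.

Lemma ord_le_trans b a c : ord_le a b -> ord_le b c -> ord_le a c.
Proof.
elim: a b c => X f IH [Y g] [Z h] /= ab bc i.
by have [j fg] := ab i; have [k gh] := bc j; exists k; apply: IH gh.
Qed.

Lemma ord_lt_le_trans b a c : ord_lt a b -> ord_le b c -> ord_lt a c.
Proof.
case: b c => Y g [Z h] /= [j agj] /(_ j) [k gh].
by exists k; apply: ord_le_trans gh.
Qed.

Lemma ord_lt_wf : well_founded ord_lt.
Proof.
suff H a b : ord_le b a -> Acc ord_lt b by move=> a; apply: (H a a (ord_le_refl a)).
elim: a b => X f IH b ba; constructor=> c cb.
by have [i /IH] := ord_lt_le_trans cb ba.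
Qed.

(** Fixes the universe of [ord] large enough for suprema over the subsets of any
    group or poset to exist. *)
Lemma ord_bounded (d : Order.disp_t) (T : porderType d) (G : groupType)
    (F : set T * set G -> ord) : exists b, forall A, ord_lt (F A) b.
Proof. by exists (Osup _ F) => A; exists A; exact: ord_le_refl. Qed.

(** * Deviation *)

(** Values of the deviation: [-1] or an ordinal. *)
Inductive devval : Type := Dminus1 | Dord of ord.

Definition dev_le (a b : devval) : Prop :=
  match a, b with
  | Dminus1, _ => True
  | Dord _, Dminus1 => False
  | Dord x, Dord y => ord_le x y
  end.

Definition dev_lt (a b : devval) : Prop :=
  match a, b with
  | _, Dminus1 => False
  | Dminus1, Dord _ => True
  | Dord x, Dord y => ord_lt x y
  end.

Lemma dev_lt_wf : well_founded dev_lt.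
Proof.
have H1 : Acc dev_lt Dminus1 by constructor; case.
case=> [|b]; first exact: H1.
apply: (well_founded_ind ord_lt_wf (fun b => Acc dev_lt (Dord b))) => c IH.
by constructor; case=> [_|a ac]; [exact: H1 | exact: IH].
Qed.

Section Deviation.
Variables (d : Order.disp_t) (T : porderType d).
Implicit Type W : set T.

(** One step of the definition of [dev W = b], in terms of the relation
    [rec a] "the deviation is [a]" for [a < b]. *)
Definition deviation_body (b : devval)
    (rec : forall a, dev_lt a b -> set T -> Prop) W : Prop :=
  match b with
  | Dminus1 => trivial_poset W
  | Dord c =>
      [/\ ord_le c Ozero, ~ trivial_poset W & min_condition W] \/
      [/\ ~ ord_le c Ozero,
          forall a (ab : dev_lt a b), ~ rec a ab W
        & forall u, descending_chain W u ->
            exists n0 : nat, forall n, (n0 <= n)%N ->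
              exists a (ab : dev_lt a b), rec a ab (factor W (u n) (u n.+1))]
  end.

(** [deviation b W] reads [dev W = b], for the order induced on [W]; see
    [deviationE]. *)
Definition deviation : devval -> set T -> Prop :=
  Fix dev_lt_wf (fun=> set T -> Prop) deviation_body.

Lemma deviationE b W :
  deviation b W <->
  match b with
  | Dminus1 => trivial_poset W
  | Dord c =>
      [/\ ord_le c Ozero, ~ trivial_poset W & min_condition W] \/
      [/\ ~ ord_le c Ozero,
          forall a, dev_lt a b -> ~ deviation a W
        & forall u, descending_chain W u ->
            exists n0 : nat, forall n, (n0 <= n)%N ->
              exists2 a, dev_lt a b & deviation a (factor W (u n) (u n.+1))]
  end.
Proof.
have -> : deviation b = deviation_body (fun a (_ : dev_lt a b) => deviation a).
  rewrite {1}/deviation Fix_eq // => x f g fg; congr deviation_body.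
  by apply/functional_extensionality_dep => a; apply/funext => ab; exact: fg.
case: b => // c; split=> -[?|[c0 ndev fin]]; (try by left); right; split=> //.
- move=> u /fin[n0 H]; exists n0 => n /H[a [ab da]]; by exists a.
- move=> u /fin[n0 H]; exists n0 => n /H[a ab da]; by exists a, ab.
Qed.

End Deviation.

(** [krull_dimension G b] reads [K(G) = b]. *)
Definition krull_dimension (G : groupType) (b : devval) : Prop :=
  deviation b (normal_subgroups G).

Definition has_krull_dimension (G : groupType) : Prop :=
  exists b, krull_dimension G b.

Definition krull_dimension_le (G : groupType) (c : devval) : Prop :=
  exists2 b, krull_dimension G b & dev_le b c.

(** * Restricted wreath products *)

(** The unrestricted wreath product [A Wr B]: pairs [(f, b)] with
    [f : B -> A], where [b] acts by [x |-> f (b^-1 * x)]. *)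
Definition full_wreath (A B : groupType) : Type := ((B -> A) * B)%type.

Section Wreath.
Variables A B : groupType.
Implicit Types u v w : full_wreath A B.

HB.instance Definition _ := gen_eqMixin (full_wreath A B).
HB.instance Definition _ := gen_choiceMixin (full_wreath A B).

Definition wreath_one : full_wreath A B := (fun=> 1, 1).
Definition wreath_inv u : full_wreath A B :=
  (fun x => (u.1 (u.2 * x))^-1, u.2^-1).
Definition wreath_mul u v : full_wreath A B :=
  (fun x => u.1 x * v.1 (u.2^-1 * x), u.2 * v.2).

Lemma wreath_mulA : associative wreath_mul.
Proof.
move=> u v w; congr pair; last by rewrite /= mulgA.
by apply/funext => x /=; rewrite invgM !mulgA.
Qed.

Lemma wreath_mul1 : left_id wreath_one wreath_mul.
Proof.
case=> f b; congr pair; last by rewrite /= mul1g.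
by apply/funext => x /=; rewrite invg1 !mul1g.
Qed.

Lemma wreath_mulr1 : right_id wreath_one wreath_mul.
Proof.
case=> f b; congr pair; last by rewrite /= mulg1.
by apply/funext => x /=; rewrite mulg1.
Qed.

Lemma wreath_mulV : left_inverse wreath_one wreath_inv wreath_mul.
Proof.
case=> f b; congr pair; last by rewrite /= mulVg.
by apply/funext => x /=; rewrite invgK mulVg.
Qed.

Lemma wreath_mulrV : right_inverse wreath_one wreath_inv wreath_mul.
Proof.
case=> f b; congr pair; last by rewrite /= mulgV.
by apply/funext => x /=; rewrite mulVKg mulgV.
Qed.

HB.instance Definition _ := isGroup.Build (full_wreath A B)
  wreath_mulA wreath_mul1 wreath_mulr1 wreath_mulV wreath_mulrV.

Definition finite_support : set (full_wreath A B) :=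
  [set u | finite_set [set x | u.1 x <> 1]].

Lemma finite_support_subgroup : is_subgroup finite_support.
Proof.
split; first by rewrite /finite_support /=; apply: sub_finite_set (finite_set0 B).
move=> u v fu fv.
apply: (@sub_finite_set _ _ ([set x | u.1 x <> 1] `|`
  [set u.2 * v.2^-1 * x | x in [set x | v.1 x <> 1]])); last first.
  by rewrite finite_setU; split=> //; exact: finite_image.
move=> x /= uvx; have [ux|] := pselect (u.1 x = 1); last by left.
right; exists (v.2 * (u.2^-1 * x)); last by rewrite !mulgA mulgVK mulgV mul1g.
by move=> vx; apply: uvx; rewrite ux vx invg1 mulg1.
Qed.

(** The restricted wreath product of [A] by [B]. *)
Definition wreath : groupType := group_of (Subgroup finite_support_subgroup).

End Wreath.

Definition Zgroup : groupType := Algebra.to_multiplicative int.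
Definition Z_wr_Z : groupType := wreath Zgroup Zgroup.

(* Main.v *)
From HB Require Import structures.
Require Import Defs.
From mathcomp Require Import all_boot.
From mathcomp Require Import all_order ssralg ssrnum ssrint intdiv finmap.
From mathcomp Require Import boolp classical_sets cardinality fsbigop.

Set Implicit Arguments.
Unset Strict Implicit.
Unset Printing Implicit Defensive.

Import Order.TTheory GRing.Theory Num.Theory.

Local Open Scope classical_set_scope.
Local Open Scope group_scope.

(** Write [V] for the torsion-free abelian group [A / t(A)], a module over [B].

    A poset with a deviation contains no strictly monotone image of the power
    set of [nat], so there is no sequence of submodules [L k] with elements
    [x k] lying in every [L i], [i <> k], but not in [L k]. Hence [V / N] has
    torsion at finitely many primes only, for every submodule [N]. As [Z wr Z]
    is not a section, each orbit of each [g] on [V] is linearly dependent, so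
    finite subsets of [V] lie in invariant isolated subgroups of finite rank.
    If [V] had infinite rank, these would form a strictly increasing chain
    [V_k], and for distinct large primes [p_k] the submodules
    [V_k + p_k V] would contradict the first observation. So [V] has finite
    rank: there are a finitely generated subgroup [F] and [m > 0] such that
    [V / F] is [m]-power torsion. Since [V] is torsion-free, the [m]-torsion of
    [V / F] embeds in [F / mF] and is finite, so [V / F] satisfies the minimal
    condition. Thus [G / t(A)] has a subnormal series whose factors are cyclic
    or satisfy the minimal condition between consecutive terms; this gives
    minimaxity, and the bound on the Krull dimension because in a descending
    chain of subgroups of a cyclic group almost all intervals are finite. *)

(** * Deviation *)

Section Deviation.
Variables (d : Order.disp_t) (T : porderType d).
Implicit Type W : set T.

(** Well-founded induction on [b]: a suitable descending chain of subsets of [nat] has infinite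
    successive differences, so each factor of its image again contains a strictly monotone copy of
    the power set, yet some factor has smaller deviation. *)
Lemma no_deviation_subsets b W (f : set nat -> T) : (forall Y, W (f Y)) ->
  (forall Y Z, Y `<` Z -> (f Y < f Z)%O) -> ~ deviation b W.
Proof.
elim/(well_founded_ind dev_lt_wf): b W f => b IH W f Wf fmono /deviationE.
have fle Y Z : Y `<=` Z -> (f Y <= f Z)%O.
  move=> YZ; have [->//|nYZ] := pselect (Y = Z); apply/ltW/fmono.
  by split=> // ZY; apply: nYZ; rewrite eqEsubset.
(* The multiples of [2 ^ n]; the differences [X n \ X n.+1] consist of the numbers
   [2 ^ n * (2k + 1)]. *)
pose X n := [set k | (2 ^ n %| k)%N].
have XS n : X n.+1 `<=` X n.
  by move=> k; apply: dvdn_trans; rewrite expnS dvdn_mull.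
have notX n k : ~ X n.+1 (2 ^ n * k.*2.+1)%N.
  by rewrite /X /= expnSr dvdn_pmul2l ?expn_gt0 // dvdn2 /= odd_double.
have ltX n : (f (X n.+1) < f (X n))%O.
  apply: fmono; split=> // /(_ (2 ^ n * 0.*2.+1)%N) H; apply: (notX n 0%N).
  by apply: H; rewrite /X /= dvdn_mulr.
case: b IH => [_ triv|c IH [[_ _ minW]|[_ _ /(_ (fun n => f (X n)))]]].
- have lt01 : (f set0 < f setT)%O.
    by apply: fmono; split=> // /(_ 0%N I).
  by have := lt01; rewrite (triv _ _ (Wf _) (Wf _) (ltW lt01)) ltxx.
- have [|| m [n _ mE] nmin] := minW (range (fun n => f (X n))).
  + by move=> _ [n _ <-].
  + by exists (f (X 0%N)); exists 0%N.
  + rewrite -mE in nmin; have := ltX n.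
    rewrite (nmin (f (X n.+1))) ?ltxx //; last exact: ltW.
case=> [n|n0 /(_ n0 (leqnn n0))[a ab]]; first by split=> //; apply: ltW.
(* A subset [Y] is coded between [X n0.+1] and [X n0] by adjoining the odd multiples of [2 ^ n0]
   indexed by [Y]. *)
apply: (IH a ab _ (fun Y =>
  f (X n0.+1 `|` [set (2 ^ n0 * k.*2.+1)%N | k in Y]))).
  move=> Y; split=> //; apply/andP; split; apply: fle => k; first by left.
  by case=> [/XS //|[j _ <-]]; rewrite /X /= dvdn_mulr.
move=> Y Z [YZ nZY]; apply: fmono; split.
  by move=> k [Xk|[j Yj <-]]; [left | right; exists j => //; apply: YZ].
move=> sub; apply: nZY => k Zk.
have [|/notX //|[j Yj /eqP]] := sub (2 ^ n0 * k.*2.+1)%N; first by right;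
  exists k.
by rewrite eqn_pmul2l ?expn_gt0 // eqSS => /eqP/double_inj <-.
Qed.

Lemma deviation_le_one W :
  (forall u, descending_chain W u -> exists n0 : nat, forall n, (n0 <= n)%N ->
     min_condition (factor W (u n) (u n.+1))) ->
  exists2 b, deviation b W & dev_le b (Dord Oone).
Proof.
move=> chainW; have [tW|ntW] := pselect (trivial_poset W).
  by exists Dminus1 => //; apply/deviationE.
have [mW|nmW] := pselect (min_condition W).
  by exists (Dord Ozero) => [|[]]; apply/deviationE; left; split=> // -[].
have nO1 : ~ ord_le Oone Ozero by case/(_ tt); case.
exists (Dord Oone); last exact: (ord_le_refl Oone).
apply/deviationE; right; split=> //.
  (* The values below one are -1 and the representations [a] of zero; both were excluded by the case
     distinction. *)
  move=> [_|a [_ a0]] /deviationE // -[[_ _ //]|[na _ _]].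
  exact: na.
move=> u /chainW[n0 H]; exists n0 => n /H mF.
have [tF|ntF] := pselect (trivial_poset (factor W (u n) (u n.+1))).
  by exists Dminus1 => //; apply/deviationE.
exists (Dord Ozero); first by exists tt; case.
by apply/deviationE; left; split=> // -[].
Qed.

End Deviation.

(** Intersecting the [L k] over all [k] outside [Y] gives a normal subgroup that grows strictly with
    [Y]: an index [k] in [Z] but not in [Y] is detected by [x k]. *)
Lemma krull_dimension_no_coindependent (G : groupType) (L : nat -> set G)
    (x : nat -> G) : has_krull_dimension G ->
  (forall k, is_normal_subgroup (L k)) ->
  (forall i k, i != k -> L i (x k)) -> (forall k, ~ L k (x k)) -> False.
Proof.
move=> [b +] nL Lx nLx.
pose f (Y : set nat) : set G := [set y | forall k, ~ Y k -> L k y].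
apply: (@no_deviation_subsets _ _ b _ f) => [Y|Y Z [YZ nZY]].
  split; first split=> [k _|y z fy fz k nk]; first by have [[]] := nL k.
    by have [[_ LF] _] := nL k; apply: LF; [apply: fy | apply: fz].
  by move=> y z fy k nk; have [_ LJ] := nL k; apply: LJ; apply: fy.
rewrite lt_neqAle; apply/andP; split.
  apply/eqP => fYZ; apply: nZY => k Zk; apply: contrapT => nYk; apply: (nLx k).
  suff : f Y (x k) by apply.
  rewrite fYZ => i nZi; apply: Lx; apply: contra_notN nZi => /eqP ->; exact: Zk.
by apply/asboolP => y fYy k nZk; apply: fYy => /YZ.
Qed.

(** * Abelian groups *)

Section Zsub.
Local Open Scope ring_scope.
Variable V : zmodType.
Implicit Types (U W : set V) (S : seq V) (x y s : V).

Definition zsub U := U 0 /\ forall x y, U x -> U y -> U (x - y).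

Lemma zsubN U x : zsub U -> U x -> U (- x).
Proof. by case=> U0 UB Ux; rewrite -[- x]add0r; apply: UB. Qed.

Lemma zsubD U x y : zsub U -> U x -> U y -> U (x + y).
Proof.
by move=> zU Ux Uy; rewrite -[y]opprK; apply: (zU.2) => //; apply: zsubN.
Qed.

Lemma zsubMn U x n : zsub U -> U x -> U (x *+ n).
Proof.
move=> zU Ux; elim: n => [|n IH]; first by rewrite mulr0n; case: zU.
by rewrite mulrS; apply: zsubD.
Qed.

Lemma zsubMz U x c : zsub U -> U x -> U (x *~ c).
Proof.
move=> zU Ux; case: c => n; first by rewrite -pmulrn; apply: zsubMn.
by rewrite NegzE mulrNz -pmulrn; apply: zsubN => //; apply: zsubMn.
Qed.

Lemma zsub_sum U I (r : seq I) (P : pred I) (F : I -> V) :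
  zsub U -> (forall i, P i -> U (F i)) -> U (\sum_(i <- r | P i) F i).
Proof. by move=> zU UF; elim/big_rec: _ => [|i x Pi Ux];
  [case: zU | apply: zsubD => //; apply: UF]. Qed.

Lemma zsubDr U x y : zsub U -> U y -> U (x + y) -> U x.
Proof. by move=> zU Uy Uxy; rewrite -(addrK y x); apply: (zU.2). Qed.

Lemma zsubMn_dvd U x m n : zsub U -> (m %| n)%N -> U (x *+ m) -> U (x *+ n).
Proof. by move=> zU /dvdnP[k ->] Ux; rewrite mulnC mulrnA; apply: zsubMn. Qed.

Lemma zsubMn_coprime U x m n :
  zsub U -> (0 < m)%N -> coprime m n -> U (x *+ m) -> U (x *+ n) -> U x.
Proof.
move=> zU m0 /eqP cmn Um Un; have [km kn eq _] := egcdnP n m0.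
suff: U (x *+ (kn * n) + x) by rewrite addrC; apply: zsubDr => //;
  rewrite mulnC mulrnA; apply: zsubMn.
by rewrite -mulrSr -addn1 -cmn -eq mulnC mulrnA; apply: zsubMn.
Qed.

(** The recursive form splits off one generator at a time, which is how the inductions on [S] below
    use it. *)
Fixpoint zspan S : set V :=
  if S is s :: S' then [set x | exists c : int, zspan S' (x - s *~ c)]
  else [set 0].

Lemma zspan_zsub S : zsub (zspan S).
Proof.
elim: S => [|s S IH] /=; first by split=> // x y -> ->; rewrite subr0.
split; first by exists 0; rewrite mulr0z subr0; case: IH.
move=> x y [c Sx] [e Sy]; exists (c - e).
have -> : x - y - s *~ (c - e) = (x - s *~ c) - (y - s *~ e).
  by rewrite mulrzBr !opprD addrACA.
exact: (IH.2).
Qed.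

Lemma zspan_mem S s : s \in S -> zspan S s.
Proof.
elim: S => //= t S IH; rewrite inE => /predU1P[->|/IH St].
  by exists 1; rewrite mulr1z subrr; case: (zspan_zsub S).
by exists 0; rewrite mulr0z subr0.
Qed.

Lemma zspan_sub S U : zsub U -> (forall s, s \in S -> U s) -> zspan S `<=` U.
Proof.
move=> zU; elim: S => [|s S IH] /= SU x; first by move=> ->; case: zU.
case=> c /IH Ux; rewrite -(subrK (s *~ c) x); apply: zsubD => //.
  by apply: Ux => t tS; apply: SU; rewrite inE tS orbT.
by apply: zsubMz => //; apply: SU; rewrite mem_head.
Qed.

Definition isolator U := [set x | exists2 n, (0 < n)%N & U (x *+ n)].

Lemma sub_isolator U : U `<=` isolator U.
Proof. by move=> x Ux; exists 1%N. Qed.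

Lemma isolator_zsub U : zsub U -> zsub (isolator U).
Proof.
move=> zU; split; first by apply: sub_isolator; case: zU.
move=> x y [m m0 Ux] [n n0 Uy]; exists (m * n)%N; first by rewrite muln_gt0 m0.
rewrite mulrnBl; apply: (zU.2); first by rewrite mulrnA; apply: zsubMn.
by rewrite mulnC mulrnA; apply: zsubMn.
Qed.

Lemma isolator_mono U W : U `<=` W -> isolator U `<=` isolator W.
Proof. by move=> UW x [n n0 /UW]; exists n. Qed.

Lemma isolator_idem U : isolator (isolator U) `<=` isolator U.
Proof.
move=> x [m m0 [n n0 Ux]]; exists (m * n)%N; first by rewrite muln_gt0 m0.
by rewrite mulrnA.
Qed.

Lemma isolator_intmul U x c : c != 0 -> zsub U -> U (x *~ c) -> isolator U x.
Proof.
case: c => n; rewrite -?pmulrn.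
  by rewrite -lt0n => n0 _; exists n.
move=> _ zU; rewrite NegzE mulrNz -pmulrn => /(zsubN zU); rewrite opprK.
by exists n.+1.
Qed.

Lemma isolator_sub S U : zsub U -> (forall s, s \in S -> isolator U s) ->
  isolator (zspan S) `<=` isolator U.
Proof.
move=> zU SU x /(@isolator_mono _ (isolator U)) H; apply: isolator_idem;
  apply: H.
by apply: zspan_sub => //; apply: isolator_zsub.
Qed.

Definition power_isolator (m : nat) U := [set x | exists k, U (x *+ m ^ k)].

Lemma power_isolator_zsub m U : zsub U -> zsub (power_isolator m U).
Proof.
move=> zU; split; first by exists 0%N; rewrite mul0rn; case: zU.
move=> x y [k Ux] [l Uy]; exists (k + l)%N; rewrite expnD mulrnBl.
apply: (zU.2); first by rewrite mulrnA; apply: zsubMn.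
by rewrite mulnC mulrnA; apply: zsubMn.
Qed.

Definition zadd U W := [set x | exists u, U u /\ W (x - u)].

Lemma zadd_zsub U W : zsub U -> zsub W -> zsub (zadd U W).
Proof.
move=> zU zW; split; first by exists 0; rewrite subrr; case: zU; case: zW.
move=> x y [u [Uu Wu]] [v [Uv Wv]]; exists (u - v); split; first exact: (zU.2).
have -> : x - y - (u - v) = (x - u) - (y - v) by rewrite !opprD addrACA.
exact: (zW.2).
Qed.


(* Solving for the first generator multiplies the remaining relations by an
   integer prime to [p]. *)
Lemma isolated_nakayama U S p : zsub U -> isolator U `<=` U -> prime p ->
  (forall s, s \in S -> exists2 c : int, ~~ (p%:Z %| c)%Z &
     exists u w, [/\ U u, zspan S w & s *~ c = u + w *~ p]) ->
  forall s, s \in S -> U s.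
Proof.
move=> zU isoU p_pr; elim: S => //= t S IH rel.
have [c0 pc0 [u [w [Uu [e Sw] tE]]]] := rel t (mem_head _ _).
(* Moving the [t]-component of [w] to the left replaces the coefficient [c0] by [q], still prime to
   [p], and leaves [w'] in the span of [S]. *)
set w' := w - t *~ e in Sw; pose q := c0 - e * p%:Z.
have pq : ~~ (p%:Z %| q)%Z by rewrite /q rpredBr ?dvdz_mull // -topredE.
have tq : t *~ q = u + w' *~ p.
  by rewrite /q mulrzBr mulrzA tE /w' mulrzBl addrA.
have SU : forall s, s \in S -> U s.
  apply: IH => s sS; have [|c pc [u1 [w1 [Uu1 [e1 Sw1] sE]]]] := rel s.
    by rewrite inE sS orbT.
  (* The relation for [s] is multiplied by [q], so that its multiple of [t] can be eliminated with
     [tq]. *)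
  exists (c * q).
    by move: pc pq; rewrite !dvdzE abszM [absz p]/= Euclid_dvdM // negb_or =>
      -> ->.
  set w1' := w1 - t *~ e1 in Sw1.
  exists (u1 *~ q + u *~ (e1 * p%:Z)), (w1' *~ q + w' *~ (e1 * p%:Z)); split.
  - by apply: zsubD => //; apply: zsubMz.
  - by have zS := zspan_zsub S; apply: zsubD => //; apply: zsubMz.
  have tE1 : t *~ (e1 * (p%:Z * q)) = u *~ (e1 * p%:Z) + w' *~ (e1 * p%:Z *
    p%:Z).
    have -> : e1 * (p%:Z * q) = q * (e1 * p%:Z) by rewrite mulrA mulrC.
    by rewrite mulrzA tq mulrzDl_tmp -mulrzA [p%:Z * _]mulrC.
  have w1E : w1 *~ (p%:Z * q) = w1' *~ (q * p%:Z) + t *~ (e1 * (p%:Z * q)).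
    by rewrite /w1' [q * _]mulrC mulrzBl -!mulrzA subrK.
  have -> : s *~ (c * q) = u1 *~ q + w1 *~ (p%:Z * q).
    by rewrite mulrzA sE mulrzDl_tmp -mulrzA.
  clearbody w' w1'; rewrite w1E tE1 mulrzDl_tmp -!mulrzA.
  by rewrite -!addrA; congr (_ + _); rewrite addrCA.
move=> s; rewrite inE => /predU1P[->|]; last exact: SU.
apply: isoU; apply: (@isolator_intmul _ _ q) => //.
  by apply: contraNneq pq => ->; rewrite dvdz0.
rewrite tq; apply: zsubD => //; apply: zsubMz => //.
exact: (zspan_sub zU SU).
Qed.

End Zsub.

Lemma exists_minimizer T (P : T -> Prop) (f : T -> nat) : (exists x, P x) ->
  exists2 x, P x & forall y, P y -> (f x <= f y)%N.
Proof.
move=> [x0 Px0]; pose Q n := `[< exists2 x, P x & f x = n >].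
have exQ : exists n, Q n by exists (f x0); apply/asboolP; exists x0.
case: (ex_minnP exQ) => n /asboolP[x Px <-] xmin; exists x => // y Py.
by apply: xmin; apply/asboolP; exists y.
Qed.

(** Turns a minimal count over a finite list into equality of two nested predicates on that list. *)
Lemma count_le_sub (T : eqType) (a b : pred T) (s : seq T) :
  (forall x, a x -> b x) -> (count b s <= count a s)%N ->
  forall x, x \in s -> b x -> a x.
Proof.
move=> ab; elim: s => //= y s IH.
have le_s : (count a s <= count b s)%N by apply: sub_count.
case ay: (a y); first rewrite (ab _ ay) /= leq_add2l => /IH{}IH x.
  by rewrite inE => /predU1P[-> //|]; apply: IH.
rewrite add0n; case byy: (b y); first by rewrite ltnNge le_s.
rewrite add0n => /IH{}IH x; rewrite inE => /predU1P[->|]; last exact: IH.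
by rewrite byy.
Qed.

(** * The minimal condition in power-torsion quotients of torsion-free groups *)

Section TorsionQuotient.
Local Open Scope ring_scope.
Variable V : zmodType.
Implicit Types (U W : set V) (S : seq V) (x y s : V).
Hypothesis tf : forall x n, (0 < n)%N -> x *+ n = 0 -> x = 0.

(** Euclidean division of every coefficient by [m] leaves finitely many combinations of
    remainders. *)
Lemma zspan_mod S m : (0 < m)%N -> exists L : seq V,
  forall x, zspan S x -> exists2 l, l \in L &
    exists2 y, zspan S y & x = l + y *+ m.
Proof.
move=> m0; elim: S => [|t S [L HL]] /=.
  by exists [:: 0] => x ->; exists 0; rewrite ?mem_head //; exists 0;
    rewrite ?mul0rn ?addr0.
exists [seq l + t *+ r | l <- L, r <- iota 0 m] => x [c /HL[l lL [y Sy xE]]].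
have m0' : (m%:Z != 0) by rewrite -lt0n.
have /ltz_pmod cm : 0 < m%:Z by rewrite ltz_nat.
have := modz_ge0 c m0'; case cE: (modz c m) (cm c) => [r|] //;
  rewrite ltz_nat => rm _.
exists (l + t *+ r); first by apply: allpairs_f => //; rewrite mem_iota.
exists (y + t *~ divz c m).
  by exists (divz c m); rewrite addrK.
have tcE : t *~ c = t *~ divz c m *+ m + t *+ r.
  by rewrite [in LHS](divz_eq c m) cE mulrzDr_tmp mulrzA -!pmulrn.
rewrite -[x](subrK (t *~ c)) xE tcE mulrnDl -!addrA; congr (_ + _).
by rewrite addrA addrC.
Qed.

(* As [V] is torsion-free, [x |-> x *+ m] embeds the [m]-torsion of
   [V / zspan S] in [zspan S / m]. *)
Lemma finite_torsion S m : (0 < m)%N -> exists L : seq V,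
  forall x, zspan S (x *+ m) -> exists2 l, l \in L & zspan S (x - l).
Proof.
move=> m0; have [L HL] := zspan_mod S m0.
pose R l := [set x | exists2 y, zspan S y & x *+ m = l + y *+ m].
(* One element is chosen from each fibre [R l]; the default 0 occurs only for empty fibres, which
   are not the fibre of any [x]. *)
exists [seq xget 0 (R l) | l <- L] => x /HL[l lL Rx].
exists (xget 0 (R l)); first exact: map_f.
have [y' Sy' x'E] := xgetPex 0 (ex_intro (R l) x Rx).
case: Rx => y Sy xE.
suff -> : x - xget 0 (R l) = y - y' by apply: (zspan_zsub S).2.
apply/eqP; rewrite -subr_eq0; apply/eqP; apply: (tf m0).
by rewrite !mulrnBl xE x'E opprD addrACA subrr add0r subrr.
Qed.

(** Two minimizations. The first stabilizes the part of the finite [m]-torsion of [V / F] met by the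
    multiples [m ^ k U], so that elements of [U] can be reduced modulo a smaller member to
    [m ^ k0]-torsion. The second stabilizes the trace on that torsion, again finite. *)
Lemma min_condition_power_torsion S m : (0 < m)%N ->
  (forall x, exists k, zspan S (x *+ m ^ k)) ->
  forall C : set (set V), C !=set0 ->
  (forall U, C U -> zsub U /\ zspan S `<=` U) ->
  exists2 U, C U & forall W, C W -> W `<=` U -> U `<=` W.
Proof.
move=> m0 tors C [U00 CU00] CP; set F := zspan S.
have zF : zsub F := zspan_zsub S.
have [L HL] := finite_torsion S m0.
(* The class of [l] modulo [F] meets [m ^ k U]. This condition gets stronger as [U] shrinks or [k]
   grows. *)
pose P U k l := `[< exists2 u, U u & F (u *+ m ^ k - l) >].
have PU U W k l : W `<=` U -> P W k l -> P U k l.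
  by move=> WU /asboolP[u Wu Fu]; apply/asboolP; exists u => //; apply: WU.
have Pk U k t l : C U -> P U (k + t)%N l -> P U k l.
  move=> /CP[zU _] /asboolP[u Uu Fu]; apply/asboolP; exists (u *+ m ^ t).
    exact: zsubMn.
  by rewrite -mulrnA -expnD addnC.
have [[U0 k0] /= CU0 min0] := @exists_minimizer (set V * nat)
  (fun z => C z.1) (fun z => count (P z.1 z.2) L) (ex_intro _ (U00, 0%N) CU00).
have {}min0 U k : C U -> (count (P U0 k0) L <= count (P U k) L)%N.
  by move=> CU; apply: (min0 (U, k)).
have [L' HL'] : exists L' : seq V,
    forall x, F (x *+ m ^ k0) -> exists2 l, l \in L' & F (x - l).
  by apply: finite_torsion; rewrite expn_gt0 m0.
have [U1 [CU1 U10] min1] := @exists_minimizer (set V)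
  (fun U => C U /\ U `<=` U0) (fun U => count (fun l => `[< U l >]) L')
  (ex_intro _ U0 (conj CU0 (@subset_refl _ U0))).
exists U1 => // W CW WU1 u U1u.
have [zU1 FU1] := CP _ CU1; have [zW FW] := CP _ CW.
have WU0 : W `<=` U0 by apply: subset_trans U10.
(* By minimality [W] meets the same [m]-torsion classes as [U0], so subtracting an element of [W]
   lowers the exponent killing [v] modulo [F] by one. *)
have descend k v : U1 v -> F (v *+ m ^ (k0 + k).+1) ->
    exists2 w, W w & F ((v - w) *+ m ^ (k0 + k)).
  move=> U1v; rewrite expnSr mulrnA => /HL[l lL Fl].
  have /asboolP[w Ww Fw] : P W (k0 + k)%N l.
    apply: (@count_le_sub _ (P W (k0 + k)%N) (P U0 k0) L) => //.
    - by move=> l' PWl'; apply: (PU U0 W) => //; apply: (Pk W k0 k).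
    - exact: min0.
    by apply: (Pk U0 k0 k) => //; apply: (PU U0 U1) => //; apply/asboolP;
      exists v.
  exists w => //; rewrite mulrnBl.
  have -> : v *+ m ^ (k0 + k) - w *+ m ^ (k0 + k) =
    (v *+ m ^ (k0 + k) - l) - (w *+ m ^ (k0 + k) - l) by rewrite opprB addrA
      subrK.
  exact: zF.2.
have {}descend k v : U1 v -> F (v *+ m ^ (k0 + k)) ->
    exists2 w, W w & F ((v - w) *+ m ^ k0).
  elim: k v => [|k IH] v U1v.
    by rewrite addn0 => Fv; exists 0; rewrite ?subr0 //; case: zW.
  rewrite addnS => /(descend _ _ U1v)[w Ww]; have U1w := WU1 _ Ww.
  have U1vw : U1 (v - w) by apply: (zU1.2).
  move=> /(IH _ U1vw)[w' Ww' Fw]; exists (w + w'); first exact: zsubD.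
  by rewrite opprD addrA.
have [k Fk] := tors u.
have [|w Ww /HL'[l lL Fl]] := descend k u U1u.
  by rewrite addnC expnD mulrnA; apply: zsubMn.
have U1uw : U1 (u - w) by apply: (zU1.2) => //; apply: WU1.
have U1l : U1 l.
  have -> : l = (u - w) - (u - w - l) by rewrite opprB addrCA subrr addr0.
  by apply: (zU1.2) => //; apply: FU1.
have Wl : W l.
  apply/asboolP; apply: (@count_le_sub _ (fun l => `[< W l >])
    (fun l => `[< U1 l >]) L') => //; last exact/asboolP.
    by move=> y /asboolP/WU1 U1y; apply/asboolP.
  by apply: min1; split.
have -> : u = (u - w - l) + (l + w) by rewrite addrA subrK subrK.
by apply: zsubD => //; [apply: FW | apply: zsubD].
Qed.
End TorsionQuotient.

(** * Modules over a group *)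

Lemma prime_dvdn_fact p n : prime p -> (p %| n`!)%N = (p <= n)%N.
Proof.
move=> p_pr; apply/idP/idP => [|pn]; last by rewrite dvdn_fact ?prime_gt0.
elim: n => [|n IH]; first by rewrite dvdn1 => /eqP p1; rewrite p1 in p_pr.
by rewrite factS Euclid_dvdM // => /orP[/dvdn_leq ->|/IH/leqW].
Qed.

Section Module.
Local Open Scope ring_scope.
Variables (G : groupType) (V : zmodType) (act : G -> V -> V) (gs : seq G).
Implicit Types (U W N : set V) (S : seq V) (x y s : V) (g h : G).

Hypothesis actB : forall g, {morph act g : x y / x - y}.
Hypothesis act1 : forall x, act 1%g x = x.
Hypothesis actM : forall g h x, act (g * h)%g x = act h (act g x).
Hypothesis actC : forall g h x, act g (act h x) = act h (act g x).

Lemma act0 g : act g 0 = 0.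
Proof. by rewrite -[X in act g X](subrr 0) actB subrr. Qed.

Lemma actN g : {morph act g : x / - x}.
Proof. by move=> x; rewrite -(sub0r x) actB act0 sub0r. Qed.

Lemma actD g : {morph act g : x y / x + y}.
Proof. by move=> x y; rewrite -{1}[y]opprK actB actN opprK. Qed.

Lemma actMn g n : {morph act g : x / x *+ n}.
Proof. by move=> x; elim: n => [|n IH];
  rewrite ?mulr0n ?act0 // !mulrS actD IH. Qed.

Lemma actMz g c : {morph act g : x / x *~ c}.
Proof.
by case: c => n x; rewrite ?NegzE ?mulrNz -?pmulrn ?actN actMn.
Qed.

Lemma actK g : cancel (act g) (act g^-1%g).
Proof. by move=> x; rewrite -actM mulgV act1. Qed.

Lemma act_sum g I (r : seq I) (P : pred I) (F : I -> V) :
  act g (\sum_(i <- r | P i) F i) = \sum_(i <- r | P i) act g (F i).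
Proof. exact: (big_morph (act g) (actD g) (act0 g)). Qed.

Definition stable g U := forall x, U x -> U (act g x).
(** Stability is asked for a finite list only: denominators are cleared for its members one by one.
    The list is later chosen closed under inverses of generators. *)
Definition submodule U := zsub U /\ forall g, g \in gs -> stable g U.


Lemma act_isolator_zspan g S U : zsub U ->
  (forall s, s \in S -> isolator U (act g s)) ->
  forall x, isolator (zspan S) x -> isolator U (act g x).
Proof.
move=> zU SU x [n n0 Sx]; apply: isolator_idem; exists n => //; rewrite -actMn.
have zT : zsub [set y | isolator U (act g y)].
  split; first by rewrite /= act0; case: (isolator_zsub zU).
  by move=> y z /= Uy Uz; rewrite actB; apply: (isolator_zsub zU).2.
exact: (zspan_sub zT SU).
Qed.

Hypothesis dep : forall g x, exists (d : nat) (c : nat -> int),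
  (exists2 i, (i < d)%N & c i != 0) /\
  \sum_(i < d) act (g ^+ i)%g x *~ c i = 0.

(** In a shortest nontrivial relation the last and the first coefficients are nonzero, for otherwise
    truncating it or applying [g^-1] shortens it. Solving for the last term handles [g ^+ d];
    solving for the first, after applying [g^-1], handles [g^-1]. *)
Lemma dep_orbit g x : exists d,
  let U := isolator (zspan [seq act (g ^+ i)%g x | i <- iota 0 d]) in
  U (act (g ^+ d)%g x) /\ U (act g^-1%g x).
Proof.
have [d [c [[i0 i0d ci0] rel]] dmin] := exists_minimizer id (dep g x).
case: d => // d in i0d rel dmin *; exists d => /=.
set U := zspan _; have zU : zsub U := zspan_zsub _.
have gU i : (i < d)%N -> U (act (g ^+ i)%g x).
  by move=> id; apply/zspan_mem/map_f; rewrite mem_iota.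
have sumU (e : nat -> int) : U (\sum_(i < d) act (g ^+ i)%g x *~ e i).
  by apply: zsub_sum => // i _; apply: zsubMz => //; apply: gU.
have gSV i : act g^-1%g (act (g ^+ i.+1)%g x) = act (g ^+ i)%g x.
  by rewrite expgSr actM actK.
have rel' : act g^-1%g x *~ c 0%N +
    \sum_(i < d) act (g ^+ i)%g x *~ c i.+1 = 0.
  rewrite -[RHS](act0 g^-1%g) -[X in _ = act _ X]rel big_ord_recl actD act_sum
    /= expg0 act1 actMz.
  by congr (_ + _); apply: eq_bigr => i _; rewrite actMz gSV.
split; last first.
  have [c0|c0] := eqVneq (c 0%N) 0; last first.
    apply: (isolator_intmul c0 zU); move/eqP: rel'; rewrite addr_eq0 => /eqP ->.
    exact: (zsubN zU (sumU (fun i => c i.+1))).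
  suff: (d.+1 <= d)%N by rewrite ltnn.
  apply: dmin; exists (fun i => c i.+1); split.
    case: i0 => [|i0] in i0d ci0 *; first by rewrite c0 in ci0.
    by exists i0.
  by move: rel'; rewrite c0 mulr0z add0r.
have [cd|cd] := eqVneq (c d) 0; last first.
  apply: (isolator_intmul cd zU); move/eqP: rel.
  rewrite big_ord_recr /= addrC addr_eq0 => /eqP ->.
  exact: zsubN.
suff: (d.+1 <= d)%N by rewrite ltnn.
apply: dmin; exists c; split.
  exists i0 => //; rewrite ltnS leq_eqVlt in i0d.
  by case/predU1P: i0d ci0 => [->|//]; rewrite cd.
by move: rel; rewrite big_ord_recr /= cd mulr0z addr0.
Qed.

Lemma stable_cover_step g S : exists S',
  [/\ {subset S <= S'}, stable g (isolator (zspan S')),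
      stable g^-1%g (isolator (zspan S')) &
      forall h, stable h (isolator (zspan S)) -> stable h (isolator (zspan
        S'))].
Proof.
have [d dP] := choice (dep_orbit g).
(* The exponents run from 0 to [d s] inclusive, so [s] itself is listed even when [d s] is 0. *)
pose S' := [seq act (g ^+ i)%g s | s <- S, i <- iota 0 (d s).+1].
have S'P s i : s \in S -> (i <= d s)%N -> act (g ^+ i)%g s \in S'.
  by move=> sS id; apply/allpairsPdep; exists s, i; rewrite mem_iota.
have zS' := zspan_zsub S'; have zU := isolator_zsub zS'.
have orbU s : s \in S -> isolator (zspan [seq act (g ^+ i)%g s | i <- iota 0 (d
  s)])
    `<=` isolator (zspan S').
  move=> sS; apply: isolator_sub => // _ /mapP[i + ->];
    rewrite mem_iota => /andP[_ id].
  by apply/sub_isolator/zspan_mem/S'P => //; apply: ltnW.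
have gS' : stable g (isolator (zspan S')).
  apply: act_isolator_zspan => // _ /allpairsPdep[s [i [sS + ->]]].
  rewrite mem_iota /= add0n ltnS leq_eqVlt -actM -expgSr => /predU1P[->|id];
    last first.
    by apply/sub_isolator/zspan_mem/S'P.
  rewrite expgSr actM; apply: (act_isolator_zspan _ _ (dP s).1) =>
    // _ /mapP[j + ->].
  rewrite mem_iota -actM -expgSr => /andP[_ jd].
  by apply/sub_isolator/zspan_mem/S'P.
exists S'; split=> //.
- by move=> s sS; rewrite -[s]act1 -(expg0 g); apply: S'P.
- apply: act_isolator_zspan => // _ /allpairsPdep[s [[|i] [sS + ->]]].
    by move=> _; rewrite expg0 act1; apply: orbU (dP s).2.
  rewrite mem_iota /= add0n ltnS => id; rewrite expgSr actM actK.
  by apply/sub_isolator/zspan_mem/S'P => //; apply: ltnW.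
(* As [h] commutes with [g], it sends [g ^+ i] applied to [s] to [g ^+ i] applied to an element of
   the old isolator, and the new one is [g]-stable. *)
move=> h hS; apply: act_isolator_zspan => // _ /allpairsPdep[s [i [sS _ ->]]].
rewrite actC; have {hS} := hS s (sub_isolator (zspan_mem sS)).
move: (act h s) => t St; elim: i => [|i IH].
  rewrite expg0 act1; apply: isolator_sub St => // u uS.
  by apply/sub_isolator/zspan_mem; have := S'P u 0%N uS isT; rewrite expg0 act1.
by rewrite expgSr actM; apply: gS'.
Qed.

Lemma stable_cover S : exists S', {subset S <= S'} /\
  forall g, g \in gs -> stable g (isolator (zspan S')).
Proof.
elim: {+}gs => [|g hs [S1 [SS1 hS1]]]; first by exists S; split.
have [S2 [S12 gS2 _ hS2]] := stable_cover_step g S1.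
exists S2; split=> [s /SS1/S12 //|h]; rewrite inE => /predU1P[-> //|/hS1].
exact: hS2.
Qed.

Hypothesis no_coindependent : forall (L : nat -> set V) (x : nat -> V),
  (forall k, submodule (L k)) -> (forall i k, i != k -> L i (x k)) ->
  (forall k, ~ L k (x k)) -> False.

(** Otherwise there are increasing primes [p k] and elements [x k] of order [p k] modulo [N]. The
    submodules [L k] of elements whose order modulo [N] divides a number prime to [p k] then
    contradict [no_coindependent]. *)
Lemma finite_torsion_primes N : submodule N -> exists b, forall p x,
  (b < p)%N -> prime p -> N (x *+ p) -> N x.
Proof.
move=> [zN gN]; apply: contrapT => noB.
have nextP b : exists z : nat * V,
    [/\ (b < z.1)%N, prime z.1, N (z.2 *+ z.1) & ~ N z.2].
  apply: contrapT => nz; apply: noB; exists b => p x bp p_pr Npx.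
  by apply: contrapT => Nx; apply: nz; exists (p, x).
have [f fP] := choice nextP.
pose p := fix p k := (f (if k is k'.+1 then p k' else 0)).1.
have pE k : exists z, [/\ prime (p k), (p k < p k.+1)%N, N (z *+ p k) & ~ N z].
  case: k => [|k] /=; [have [_ pp Nx nx] := fP 0%N | have [_ pp Nx nx] := fP (p
    k)].
    by exists (f 0%N).2; split=> //; have [] := fP (f 0%N).1.
  by exists (f (p k)).2; split=> //; have [] := fP (f (p k)).1.
have [x xP] := choice pE.
have p_inj i k : i != k -> p i != p k.
  have pmono a b : (a < b)%N -> (p a < p b)%N.
    elim: b => // b IH; rewrite ltnS leq_eqVlt => /predU1P[->|/IH ab].
      by have [] := xP b.
    by apply: ltn_trans ab _; have [] := xP b.
  by rewrite !neq_ltn => /orP[/pmono ->|/pmono ->]; rewrite ?orbT.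
pose L k := [set y | exists2 n, coprime (p k) n & N (y *+ n)].
apply: (no_coindependent (L := L) (x := x)).
- move=> k; split=> [|g ggs y [n cn Ny]]; last first.
    by exists n => //; rewrite -actMn; apply: gN.
  split; first by exists 1%N; rewrite ?coprimen1 // mulr1n; case: zN.
  move=> y z [m cm Ny] [n cn Nz]; exists (m * n)%N;
    first by rewrite coprimeMr cm.
  rewrite mulrnBl; apply: zN.2; first by rewrite mulrnA; apply: zsubMn.
  by rewrite mulnC mulrnA; apply: zsubMn.
- move=> i k ik; have [pi _ _ _] := xP i; have [pk _ Nk _] := xP k.
  by exists (p k) => //; rewrite prime_coprime // dvdn_prime2 // p_inj.
- move=> k [n cn Nn]; have [pk _ Nk nNk] := xP k.
  by apply: nNk; apply: (zsubMn_coprime zN _ cn) => //; apply: prime_gt0.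
Qed.

(** The exponent [n] is large enough because the multiplicity of a prime in [n] is less than [n]. *)
Lemma dvdn_expn_primes m n : (0 < n)%N ->
  (forall p, prime p -> (p %| n)%N -> (p %| m)%N) -> (n %| m ^ n)%N.
Proof.
move=> n0 pm; case: (posnP m) => [->|m0]; first by rewrite exp0n.
apply/dvdn_partP => // p; rewrite mem_primes => /and3P[p_pr _ pn].
rewrite p_part pfactor_dvdn ?expn_gt0 ?m0 // lognX.
rewrite (leq_trans (ltnW (ltn_logl p n0))) // leq_pmulr // logn_gt0 mem_primes.
by rewrite p_pr m0 pm.
Qed.

(** A prime above the bound [b] can be cancelled from any annihilator modulo [N], so the least one,
    [n], has only prime factors up to [b] and divides a power of the factorial of [b]. *)
Lemma isolator_power_isolator N : submodule N -> exists2 m, (0 < m)%N &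
  isolator N `<=` power_isolator m N.
Proof.
move=> sN; have zN := sN.1; have [b bP] := finite_torsion_primes sN.
exists b`!; first exact: fact_gt0.
move=> x xN; have {xN}[n [n0 Nx] nmin] : exists2 n, (0 < n)%N /\ N (x *+ n) &
    forall k, (0 < k)%N /\ N (x *+ k) -> (n <= k)%N.
  by apply: (exists_minimizer id); case: xN => n; exists n.
exists n; apply: (zsubMn_dvd zN _ Nx); apply: dvdn_expn_primes => // p p_pr.
move=> /dvdnP[k nE]; rewrite dvdn_fact ?prime_gt0 //= leqNgt.
apply/negP => bp; move: n0 Nx nmin; rewrite {n}nE muln_gt0 => /andP[k0 p0].
rewrite mulrnA => /(bP _ _ bp p_pr) Nk /(_ k (conj k0 Nk)).
by rewrite leqNgt ltn_Pmulr // prime_gt1.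
Qed.

(** The span itself need not be stable, but the images of its generators under [gs] have a common
    denominator [m0]. Its [m0]-power isolator is therefore a submodule, to which
    [isolator_power_isolator] applies. *)
Lemma isolator_zspan_power S :
  (forall g, g \in gs -> stable g (isolator (zspan S))) ->
  exists2 m, (0 < m)%N & isolator (zspan S) `<=` power_isolator m (zspan S).
Proof.
move=> gS; have zS := zspan_zsub S.
have [m0 m00 m0P] : exists2 m, (0 < m)%N &
    forall g s, g \in gs -> s \in S -> zspan S (act g s *+ m).
  have exn (z : G * V) : exists n, (0 < n)%N /\
      (z.1 \in gs -> z.2 \in S -> zspan S (act z.1 z.2 *+ n)).
    have [zgs|] := boolP (z.1 \in gs); last by exists 1%N.
    have [zS1|] := boolP (z.2 \in S); last by exists 1%N.
    by have [n n0 Sn] := gS _ zgs _ (sub_isolator (zspan_mem zS1)); exists n.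
  have [n nP] := choice exn.
  exists (\prod_(z <- [seq (g, s) | g <- gs, s <- S]) n z)%N.
    by apply: prodn_gt0 => z; case: (nP z).
  move=> g s ggs sS; have [_ /(_ ggs sS)] := nP (g, s).
  apply: zsubMn_dvd => //=.
  by rewrite (big_rem (g, s)) ?dvdn_mulr //; apply: allpairs_f.
have sub : submodule (power_isolator m0 (zspan S)).
  split=> [|g ggs x [k Sx]]; first exact: power_isolator_zsub.
  exists k.+1; rewrite expnSr mulrnA -actMn.
  have zT : zsub [set y | zspan S (act g y *+ m0)].
    split; first by rewrite /= act0 mul0rn; case: zS.
    by move=> y z /= Sy Sz; rewrite actB mulrnBl; apply: zS.2.
  by apply: (zspan_sub zT) Sx => s sS; apply: m0P.
have [m1 m10 m1P] := isolator_power_isolator sub.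
exists (m0 * m1)%N; first by rewrite muln_gt0 m00.
move=> x Sx; have [|k [l]] := m1P x.
  by apply: isolator_mono Sx => y Sy; exists 0%N.
rewrite -mulrnA => Skl; exists (k + l)%N; apply: zsubMn_dvd Skl => //.
by rewrite expnMn mulnC; apply: dvdn_mul; apply: dvdn_exp2l;
  rewrite (leq_addr, leq_addl).
Qed.

Lemma finite_rank : exists S, forall x, isolator (zspan S) x.
Proof.
apply: contrapT => nS.
pose stab S := forall g, g \in gs -> stable g (isolator (zspan S)).
pose I S := isolator (zspan S).
have zI S : zsub (I S) by apply: isolator_zsub; apply: zspan_zsub.
(* One step of the chain: a larger stable isolated subgroup [I S'], a larger prime [p'], and an
   element [y] of [I S'] outside [I S + p' V]. *)
have step S p : stab S -> exists S' p' y, [/\ stab S' /\ I S `<=` I S',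
  (p < p')%N,
    prime p', I S' y & forall u v, I S u -> y <> u + v *+ p'].
  move=> sS; have [y0 ny0] : exists y, ~ I S y.
    by apply: contrapT => /forallNP H; apply: nS; exists S => x;
      apply: contrapT (H x).
  have [S' [SS' sS']] := stable_cover (y0 :: S).
  have [m m0 mP] := isolator_zspan_power sS'.
  have ISS' : I S `<=` I S'.
    apply: isolator_mono; apply: zspan_sub; first exact: zspan_zsub.
    by move=> s sS0; apply/zspan_mem/SS'; rewrite inE sS0 orbT.
  (* A prime above [m] does not divide [m ^ k]. Without such a [y], each generator of [S'] would
     satisfy a relation with coefficient [m ^ k], and [isolated_nakayama] would put [S'] inside
     [I S]. *)
  have [p' pp' p'_pr] := prime_above (maxn p m).
  move: pp'; rewrite gtn_max => /andP[pp' mp'].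
  exists S', p'; apply: contrapT => noy; apply: ny0.
  have in_sum y : I S' y -> exists u v, I S u /\ y = u + v *+ p'.
    move=> yS'; apply: contrapT => nuv; apply: noy; exists y;
      split=> // u v Su yE.
    by apply: nuv; exists u, v.
  suff H : forall s, s \in S' -> I S s by apply: H; apply: SS';
    rewrite mem_head.
  apply: (isolated_nakayama (zI S) _ p'_pr); first exact: isolator_idem.
  move=> s sS0; have Ss : I S' s by apply/sub_isolator/zspan_mem.
  have [u [v [Su sE]]] := in_sum s Ss.
  have /mP[k Sk] : I S' v.
    apply: isolator_idem; exists p'; first exact: prime_gt0.
    have -> : v *+ p' = s - u by rewrite sE addrC addKr.
    by apply: (zI S').2 => //; apply: ISS'.
  exists (m ^ k)%N%:Z.
    by rewrite dvdzE /= Euclid_dvdX // negb_and gtnNdvd.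
  exists (u *+ m ^ k), (v *+ m ^ k); split=> //; first exact: zsubMn.
  by rewrite -!pmulrn sE mulrnDl -!mulrnA mulnC.
have {}step (z : seq V * nat) : exists z' : seq V * nat * V, stab z.1 ->
    [/\ stab z'.1.1 /\ I z.1 `<=` I z'.1.1, (z.2 < z'.1.2)%N,
    prime z'.1.2, I z'.1.1 z'.2 & forall u v,
      I z.1 u -> z'.2 <> u + v *+ z'.1.2].
  have [/(step _ z.2)[S' [p' [y H]]]|] := pselect (stab z.1);
    first by exists (S', p', y).
  (* A dummy value for unstable [z.1]; the iteration starts at a stable list and stays among stable
     ones. *)
  by exists ([::], 0%N, 0).
have [f fP] := choice step.
have [S0 [_ sS0]] := stable_cover [::].
pose q k := iter k (fun z => (f z).1) (S0, 0%N).
have sq k : stab (q k).1 by elim: k => //= k /fP[[]].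
pose T k := I (q k).1; pose p k := (q k.+1).2; pose y k := (f (q k)).2.
have pr k : prime (p k) by have [] := fP (q k) (sq k).
have Ty k : T k.+1 (y k) by have [] := fP (q k) (sq k).
have nTy k u v : T k u -> y k <> u + v *+ p k.
  by have [_ _ _ _] := fP (q k) (sq k); apply.
have pmono i k : (i < k)%N -> (p i < p k)%N.
  elim: k => // k IH; rewrite ltnS leq_eqVlt => /predU1P[->|/IH ik].
    by have [] := fP (q k.+1) (sq k.+1).
  by apply: ltn_trans ik _; have [] := fP (q k.+1) (sq k.+1).
have Tmono i k : (i <= k)%N -> T i `<=` T k.
  elim: k => [|k IH]; first by rewrite leqn0 => /eqP ->.
  rewrite leq_eqVlt ltnS => /predU1P[-> //|/IH Tik] x /Tik.
  by have [[_ +] _ _ _ _] := fP (q k) (sq k); apply.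
pose pV k := [set x | exists v : V, x = v *+ p k].
have zpV k : zsub (pV k).
  split; first by exists 0; rewrite mul0rn.
  by move=> _ _ [u ->] [v ->]; exists (u - v); rewrite mulrnBl.
pose L k := zadd (T k) (pV k).
(* The factorial is divisible by every earlier prime [p i], which puts the element in [L i] for
   [i < k], and is prime to [p k], which keeps it out of [L k]. For [i > k] already [T i] contains
   [y k]. *)
apply: (no_coindependent (L := L) (x := fun k => y k *+ ((p k).-1)`!)).
- move=> k; split=> [|g ggs x [u [Tu [v xE]]]];
  first by apply: zadd_zsub => //; apply: zI.
  exists (act g u); split; first by apply: sq.
  by exists (act g v); rewrite -actB xE actMn.
- move=> i k; rewrite neq_ltn => /orP[ik|ki].
    exists 0; split; first by case: (zI (q i).1).
    have /dvdnP[n ->] : (p i %| (p k).-1`!)%N.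
      rewrite dvdn_fact // prime_gt0 //= -ltnS prednK ?prime_gt0 //;
        exact: pmono.
    by exists (y k *+ n); rewrite subr0 mulrnA.
  exists (y k *+ ((p k).-1)`!); split; last by exists 0; rewrite subrr mul0rn.
  by apply: zsubMn; [exact: zI | apply: (Tmono k.+1)].
- move=> k Ly; have zL : zsub (L k) by apply: zadd_zsub => //; apply: zI.
  have [u [Tu [v yE]]] : L k (y k).
    apply: (@zsubMn_coprime _ _ _ (p k) (p k).-1`!) Ly => //;
      first exact: prime_gt0.
      by rewrite prime_coprime // prime_dvdn_fact // -ltnNge prednK ?prime_gt0.
    exists 0; split; first by case: (zI (q k).1).
    by exists (y k); rewrite subr0.
  by apply: (nTy k u v Tu); rewrite -yE addrC subrK.
Qed.

Theorem finite_rank_power : exists S m, (0 < m)%N /\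
  forall x, exists k, zspan S (x *+ m ^ k).
Proof.
have [S SP] := finite_rank.
have [|m m0 mP] := @isolator_zspan_power S; first by move=> g _ x _; apply: SP.
by exists S, m; split=> // x; apply: mP.
Qed.
End Module.

(** * Subnormal series *)

HB.instance Definition _ (G : groupType) (N : normal_subgroup G) :=
  Multiplicative_isUMagmaMorphism.Build G (quotient_group N) (quotient_proj N)
    (erefl _).

Section Subgroups.
Variable G : groupType.
Implicit Types H U W : set G.

Lemma subgroupV H x : is_subgroup H -> H x -> H x^-1.
Proof. by move=> [H1 HF] Hx; rewrite -[x^-1]mul1g; apply: HF. Qed.

Lemma subgroupM H x y : is_subgroup H -> H x -> H y -> H (x * y).
Proof.
by move=> sH Hx Hy; rewrite -[y]invgK; apply: sH.2 => //; apply: subgroupV.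
Qed.

Lemma subgroupX H x n : is_subgroup H -> H x -> H (x ^+ n).
Proof.
move=> sH Hx; elim: n => [|n IH]; first by case: sH.
by rewrite expgS; apply: subgroupM.
Qed.

Lemma subgroupMl H x y : is_subgroup H -> H x -> H (x * y) -> H y.
Proof.
by move=> sH Hx Hxy; rewrite -(mulKg x y); apply: subgroupM => //;
  apply: subgroupV.
Qed.

Lemma subgroupMr H x y : is_subgroup H -> H y -> H (x * y) -> H x.
Proof. by move=> sH Hy Hxy; rewrite -(mulgK y x); apply: sH.2. Qed.

Lemma subgroupX_mod H x N k : is_subgroup H -> H (x ^+ N) ->
  H (x ^+ k) <-> H (x ^+ (k %% N)).
Proof.
move=> sH HN; have Hq : H (x ^+ (k %/ N * N)).
  by rewrite mulnC expgnA; apply: subgroupX.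
by rewrite {1}(divn_eq k N) expgnDr; split=> [/(subgroupMl sH Hq)|];
  [|apply: subgroupM].
Qed.

Definition interval H H' U := [/\ is_subgroup U, H `<=` U & U `<=` H'].

(** The chain conditions on the factor [H' / H] are expressed by subgroups of [G] itself, so that no
    quotient has to be formed before [minimax_step]. *)
Definition interval_min H H' := forall C : set (set G), C !=set0 ->
  C `<=` interval H H' ->
  exists2 U, C U & forall W, C W -> W `<=` U -> U `<=` W.

Definition interval_max H H' := forall C : set (set G), C !=set0 ->
  C `<=` interval H H' ->
  exists2 U, C U & forall W, C W -> U `<=` W -> W `<=` U.

Definition cyclic_factor H H' := exists2 g, H' g &
  forall x, H' x -> exists n, H (x * g ^+ n) \/ H (x / g ^+ n).

(* A subgroup between [H] and [H'] is determined by the exponents of the powers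
   of a generator of [H' / H] that it contains. *)
Lemma interval_cyclic_sub H H' g U W :
  (forall x, H' x -> exists n, H (x * g ^+ n) \/ H (x / g ^+ n)) ->
  interval H H' U -> interval H H' W ->
  (forall n, U (g ^+ n) -> W (g ^+ n)) -> U `<=` W.
Proof.
move=> cyc [sU HU UH'] [sW HW _] UW x Ux; have [n [Hx|Hx]] := cyc x (UH' x Ux).
  have Wg : W (g ^+ n) by apply: UW; apply: (subgroupMl sU Ux); apply: HU.
  by apply: (subgroupMr sW Wg); apply: HW.
have Wg : W (g ^+ n).
  apply: UW; rewrite -[_ ^+ n]invgK; apply: subgroupV => //.
  by apply: (subgroupMl sU Ux); apply: HU.
by apply: (subgroupMr sW (subgroupV sW Wg)); apply: HW.
Qed.

(** A member containing a positive power [g ^+ n] with [n] least is maximal: in a larger member, an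
    exponent not divisible by [n] would leave a smaller positive remainder. If no member contains a
    positive power, all members coincide. *)
Lemma cyclic_factor_max H H' : cyclic_factor H H' -> interval_max H H'.
Proof.
move=> [g H'g cyc] C [U0 CU0] CI.
pose P (z : set G * nat) := [/\ C z.1, (0 < z.2)%N & z.1 (g ^+ z.2)].
have [exP|nP] := pselect (exists z, P z); last first.
  exists U0 => // W CW UW; apply: (interval_cyclic_sub cyc); try exact: CI.
  move=> [|n] Wn; first by have [[]] := CI _ CU0.
  by case: nP; exists (W, n.+1).
have [[U n] [/= CU n0 Un] nmin] := exists_minimizer (fun z => z.2) exP.
exists U => // W CW UW; apply: (interval_cyclic_sub cyc); try exact: CI.
have [sW _ _] := CI _ CW; have [sU _ _] := CI _ CU.
move=> k /(subgroupX_mod k sW (UW _ Un)) Wr.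
apply/(subgroupX_mod k sU Un); have [r0|r0] := posnP (k %% n).
  by rewrite r0; case: sU.
have : P (W, k %% n) by split.
by move=> /nmin /=; rewrite leqNgt ltn_pmod.
Qed.

(** If some term contains no positive power of [g], the later intervals are single subgroups.
    Otherwise [u n.+1] contains some [g ^+ N] with [N > 0], and a member of the interval is
    determined by its exponents below [N]. *)
Lemma cyclic_factor_chain H H' (u : nat -> set G) : cyclic_factor H H' ->
  (forall n, interval H H' (u n)) -> (forall n, u n.+1 `<=` u n) ->
  exists n0 : nat, forall n, (n0 <= n)%N -> interval_min (u n.+1) (u n).
Proof.
move=> [g H'g cyc] uI uS.
have IH' n U : interval (u n.+1) (u n) U -> interval H H' U.
  move=> [sU uU Uu]; have [_ Hu _] := uI n.+1; have [_ _ uH] := uI n.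
  by split=> // x; [move/Hu; apply: uU | move/Uu; apply: uH].
have [[n0 un0]|nz] := pselect (exists n0, forall k,
  (0 < k)%N -> ~ u n0 (g ^+ k)).
  exists n0 => n n0n C [U0 CU0] CI; exists U0 => // W CW _.
  apply: (interval_cyclic_sub cyc); try by apply: IH'; apply: CI.
  have un : u n `<=` u n0.
    elim: n n0n {CI} => [|m IHm]; first by rewrite leqn0 => /eqP ->.
    by rewrite leq_eqVlt => /predU1P[<-//|/IHm um] x /uS /um.
  move=> [|k] Uk; first by have [[]] := CI _ CW.
  by case: (un0 k.+1) => //; apply: un; have [_ _] := CI _ CU0; apply.
exists 0%N => n _ C [U0 CU0] CI.
have [N N0 uN] : exists2 N, (0 < N)%N & u n.+1 (g ^+ N).
  apply: contrapT => nN; apply: nz; exists n.+1 => k k0 uk.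
  by apply: nN; exists k.
have [U CU Umin] := exists_minimizer
  (fun U : set G => count (fun k =>
    `[< U (g ^+ k) >]) (iota 0 N)) (ex_intro _ U0 CU0).
exists U => // W CW WU; apply: (interval_cyclic_sub cyc); try by apply: IH';
  apply: CI.
have [sW uW _] := CI _ CW; have [sU uU _] := CI _ CU.
move=> k /(subgroupX_mod k sU (uU _ uN)) Uk.
apply/(subgroupX_mod k sW (uW _ uN)).
apply/asboolP; apply: (count_le_sub _ (Umin W CW)); last exact/asboolP.
  by move=> j /asboolP/WU Uj; apply/asboolP.
by rewrite mem_iota ltn_pmod.
Qed.

(** Cyclic factors are kept as such, rather than weakened to the maximal condition, because the
    bound on the Krull dimension rests on [cyclic_factor_chain]. *)
Inductive series : set G -> Prop :=
| series1 : series [set 1]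
| seriesS H H' : series H -> is_subgroup H' -> H `<=` H' ->
    (forall x y, H x -> H' y -> H (x ^ y)) ->
    interval_min H H' \/ cyclic_factor H H' -> series H'.

Lemma series_subgroup H : series H -> is_subgroup H.
Proof.
case=> // ; split=> // x y -> ->; by rewrite divg1.
Qed.

(* The trace [(U :&: H') H] of [U] on the factor [H' / H]. *)
Definition factor_trace H H' U := [set y | H' y /\ exists2 h, H h & U (h * y)].

Lemma factor_trace_interval H H' U : is_subgroup H -> is_subgroup H' ->
  H `<=` H' -> (forall x y, H x -> H' y -> H (x ^ y)) -> is_subgroup U ->
  interval H H' (factor_trace H H' U).
Proof.
move=> sH sH' HH' nH sU; split=> [|x Hx|x []//].
  split; first by split; [case: sH' | exists 1; rewrite ?mulg1;
    [case: sH | case: sU]].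
  move=> x y [H'x [h Hh Ux]] [H'y [k Hk Uy]]; split; first exact: sH'.2.
  exists (h * (k^-1 ^ (x / y)^-1)).
    apply: subgroupM => //; apply: nH; first exact: subgroupV.
    by apply: subgroupV => //; apply: sH'.2.
  have -> : h * k^-1 ^ (x / y)^-1 * (x / y) = (h * x) / (k * y).
    by rewrite -mulgA -conjgCV invgM !mulgA.
  exact: sU.2.
split; first exact: HH'.
by exists x^-1; [exact: subgroupV | rewrite mulVg; case: sU].
Qed.

(** Induction along the series: [U0] is chosen minimal on [H], then [U] below [U0] with minimal
    trace on [H' / H]. A modular-law argument combines the two. *)
Lemma series_chain H (u : nat -> set G) : series H ->
  (forall n, is_subgroup (u n)) -> (forall n, u n.+1 `<=` u n) ->
  exists n0 : nat, forall n, (n0 <= n)%N ->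
  forall C : set (set G), C !=set0 -> C `<=` interval (u n.+1) (u n) ->
  exists2 U, C U & forall W, C W -> W `<=` U -> U `&` H `<=` W.
Proof.
move=> serH su uS; elim: serH => [|{}H H' serH [n0 IH] sH' HH' nH fac].
  exists 0%N => n _ C [U CU] CI; exists U => // W CW _ x [_ ->].
  by have [[]] := CI _ CW.
have sH := series_subgroup serH.
pose tr := factor_trace H H'.
have tr_mono U W : U `<=` W -> tr U `<=` tr W.
  by move=> UW y [H'y [h Hh Uhy]]; split=> //; exists h => //; apply: UW.
have trI U : is_subgroup U -> interval H H' (tr U) by exact:
  factor_trace_interval.
have [n1 n1P] : exists n1 : nat, forall n, (n1 <= n)%N ->
    interval_min (tr (u n.+1)) (tr (u n)).
  case: fac => [mH|cH].
    exists 0%N => n _ C C0 CI; apply: mH => // U /CI[sU lU Uu].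
    have [_ Hu _] := trI _ (su n.+1); have [_ _ uH'] := trI _ (su n).
    by split=> // x; [move/Hu; apply: lU | move/Uu; apply: uH'].
  by apply: (cyclic_factor_chain cH) => n; [apply: trI | apply: tr_mono].
exists (maxn n0 n1) => n; rewrite geq_max => /andP[/IH{}IH /n1P{}n1P] C C0 CI.
have [U0 CU0 U0min] := IH C C0 CI.
have [||_ [U [CU UU0] <-] Umin] := n1P [set tr U | U in [set U | C U /\ U `<=`
  U0]].
- by exists (tr U0), U0; first split.
- move=> _ [U [/CI[sU uU Uu] _] <-]; split; last exact: tr_mono;
  last exact: tr_mono.
  by have [] := trI U sU.
exists U => // W CW WU x [Ux H'x].
have [sW _ _] := CI _ CW; have [sU _ _] := CI _ CU.
have WU0 : W `<=` U0 by apply: subset_trans UU0.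
have [_ [h Hh Whx]] : tr W x.
  apply: Umin; first by exists W.
    exact: tr_mono.
  by split=> //; exists 1; [case: sH | rewrite mul1g].
(* Both [h * x] and [x] lie in [U], so [h] lies in [U0] and in [H], and the choice of [U0] puts it
   in [W]. *)
suff Wh : W h by apply: (subgroupMl sW Wh).
apply: (U0min W CW WU0); split=> //; apply: UU0.
by apply: (subgroupMr sU Ux); apply: WU.
Qed.

Lemma series_krull : series [set: G] -> krull_dimension_le G (Dord Oone).
Proof.
move=> ser; apply: deviation_le_one => u du.
have [|n|n0 n0P] := series_chain (u := u) ser.
- by move=> n; have [[]] := du n.
- by have [_ /asboolP] := du n.
exists n0 => n /n0P H C CF C0; have [||U CU Umin] := H C => //.
  by move=> U /CF[[sU _] /andP[/asboolP ? /asboolP ?]].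
exists U => // W CW WU; apply/le_anti/andP; split=> //.
apply/asboolP => x Ux; apply: (Umin W CW); first exact/asboolP.
by split.
Qed.

(** * From series to minimax groups *)

Section Minimax.
Variables (A B : subgroup G).
Hypothesis AB : subgroup_set A `<=` subgroup_set B.
Hypothesis nA : forall x y, subgroup_set A x -> subgroup_set B y ->
  subgroup_set A (x ^ y).

Lemma group_ofP (x : group_of B) : subgroup_set B (val x).
Proof. by have := valP x; rewrite inE. Qed.

Lemma group_of_val1 : val (1 : group_of B) = 1.
Proof. by rewrite val1. Qed.

Lemma normal_group_of : is_normal_subgroup [set x : group_of B | subgroup_set A
  (val x)].
Proof.
have sA := subgroupP A.
split; first split=> [|x y /= Ax Ay]; first by have := sA.1;
  rewrite -group_of_val1.
  by change (subgroup_set A (val (x / y))); rewrite gmulfF; apply: sA.2.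
by move=> x y /= Ax; change (subgroup_set A (val (x ^ y))); rewrite gmulfJ;
  apply: nA => //; apply: group_ofP.
Qed.

Let N := NormalSubgroup normal_group_of.

Lemma image_normal_group_of :
  subgroup_set A = [set val x | x in normal_subgroup_set N].
Proof.
rewrite eqEsubset; split=> [x Ax|_ [x Ax <-] //].
by have /mem_set Bx := AB Ax; exists (Sub x Bx : group_of B); rewrite ?SubK.
Qed.

Definition pullback (X : set (quotient_group N)) : set G :=
  [set val y | y in [set y : group_of B | X (quotient_proj N y)]].

Lemma pullback_interval X : is_subgroup X ->
  interval (subgroup_set A) (subgroup_set B) (pullback X).
Proof.
move=> sX; split; last by move=> _ [x _ <-]; apply: group_ofP.
  split; first by exists 1; [case: sX | exact: group_of_val1].
  move=> _ _ [x Xx <-] [y Xy <-]; exists (x / y); last by rewrite gmulfF.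
  by change (X (quotient_proj N (x / y))); rewrite gmulfF; apply: sX.2.
rewrite image_normal_group_of => _ [x Nx <-]; exists x => //=.
have -> : quotient_proj N x = 1.
  by apply/esym/quotient_eqP; rewrite invg1 mul1g.
by case: sX.
Qed.

Lemma pullback_sub X Y : pullback X `<=` pullback Y -> X `<=` Y.
Proof.
move=> XY q Xq; have [x qE] := quotient_projP q; rewrite qE in Xq *.
by have [|y Yy /val_inj <-] := XY (val x); first by exists x.
Qed.

Lemma pullback_mono X Y : X `<=` Y -> pullback X `<=` pullback Y.
Proof. by move=> XY _ [x Xx <-]; exists x => //; apply: XY. Qed.

Lemma minimax_step :
  interval_min (subgroup_set A) (subgroup_set B) \/
    interval_max (subgroup_set A) (subgroup_set B) ->
  min_subgroups (quotient_group N) \/ max_subgroups (quotient_group N).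
Proof.
case=> HI; [left | right] => S sS [X0 SX0].
  have [||_ [X SX <-] Xmin] := HI (pullback @` S).
  - by exists (pullback X0), X0.
  - by move=> _ [X /sS sX <-]; apply: pullback_interval.
  exists X => // Y SY /asboolP YX; apply/le_anti/andP; split;
    apply/asboolP => //.
  apply: pullback_sub; apply: Xmin; first by exists Y.
  exact: pullback_mono.
have [||_ [X SX <-] Xmax] := HI (pullback @` S).
- by exists (pullback X0), X0.
- by move=> _ [X /sS sX <-]; apply: pullback_interval.
exists X => // Y SY /asboolP XY; apply/le_anti/andP; split; apply/asboolP => //.
apply: pullback_sub; apply: Xmax; first by exists Y.
exact: pullback_mono.
Qed.

End Minimax.

Lemma series_minimax : series [set: G] -> minimax G.
Proof.
pose step (A B : subgroup G) := exists N : normal_subgroup (group_of B),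
  subgroup_set A = [set val x | x in normal_subgroup_set N] /\
  (min_subgroups (quotient_group N) \/ max_subgroups (quotient_group N)).
suff H U : series U -> exists (n : nat) (S : nat -> subgroup G),
    [/\ subgroup_set (S 0%N) = [set 1], subgroup_set (S n) = U
      & forall i, (i < n)%N -> step (S i) (S i.+1)] by apply: H.
elim=> [|{}U U' serU [n [S [S0 Sn stepS]]] sU' UU' nU fac].
  have s1 : is_subgroup [set 1 : G] by apply: series_subgroup series1.
  by exists 0%N, (fun=> Subgroup s1).
exists n.+1, (fun i => if (i <= n)%N then S i else Subgroup sU').
split=> //; first by rewrite ltnn.
move=> i; rewrite ltnS => le_in; rewrite le_in; case: ltnP => [/stepS //|ni].
have {i ni le_in}-> : i = n by apply/eqP; rewrite eqn_leq le_in.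
have SU : subgroup_set (S n) `<=` subgroup_set (Subgroup sU') by rewrite Sn.
have nS x y : subgroup_set (S n) x -> subgroup_set (Subgroup sU') y ->
  subgroup_set (S n) (x ^ y) by rewrite Sn; apply: nU.
exists (NormalSubgroup (normal_group_of nS)); split.
  exact: image_normal_group_of.
apply: minimax_step => //; rewrite Sn /=.
by case: fac => [|/cyclic_factor_max]; [left | right].
Qed.

End Subgroups.

(** * Wreath product sections *)

Section EmbeddingSection.
Variables (G W : groupType) (theta : W -> G).
Hypothesis thetaM : {morph theta : x y / x * y}.
Hypothesis theta_inj : injective theta.

Lemma range_subgroup : is_subgroup (range theta).
Proof.
have theta1 : theta 1 = 1 by apply: (mulgI (theta 1)); rewrite -thetaM !mulg1.
split; first by exists 1.
move=> _ _ [x _ <-] [y _ <-]; exists (x / y) => //.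
by apply: (mulIg (theta y)); rewrite -thetaM !mulgVK.
Qed.

Lemma trivial_normal : is_normal_subgroup [set 1 : G].
Proof.
split; first by split=> // x y -> ->; rewrite divg1.
by move=> x y ->; rewrite conj1g.
Qed.
End EmbeddingSection.

Lemma injective_has_section (G W : groupType) (theta : W -> G) :
  {morph theta : x y / x * y} -> injective theta -> has_section G W.
Proof.
move=> thetaM theta_inj; pose H := Subgroup (range_subgroup thetaM).
exists H, (NormalSubgroup (trivial_normal (group_of H)));
  set K := NormalSubgroup _.
(* Since [K] is trivial, a class has only one representative, and [rho] inverts the projection
   followed by the inclusion in [G]. *)
pose rho (q : quotient_group K) : G := val (repr q : group_of H).
have rhoE x : rho (quotient_proj K x) = val x.
  by have /(congr1 (fun y => x * y)) := repr_quotient_proj K x;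
    rewrite mulVKg mulg1 /rho => ->.
have rhoM : {morph rho : p q / p * q}.
  move=> p q; have [x ->] := quotient_projP p; have [y ->] := quotient_projP q.
  by rewrite -gmulfM !rhoE gmulfM.
have exf q : exists w, theta w = rho q.
  by have [w _ wE] := group_ofP (repr q : group_of H); exists w.
have [f fE] := choice exf.
have fM : {morph f : p q / p * q}.
  by move=> p q; apply: theta_inj; rewrite thetaM !fE rhoM.
exists (HB.pack_for {multiplicative quotient_group K -> W} f
  (isMultiplicative.Build _ _ f fM)) => /=.
have thetaH w : theta w \in subgroup_set H by apply/mem_set; exists w.
exists (fun w => quotient_proj K (Sub (theta w) (thetaH w) : group_of H)) =>
  [q|w].
  have [x ->] := quotient_projP q; congr quotient_proj; apply: val_inj.
  by rewrite SubK fE rhoE.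
by apply: theta_inj; rewrite fE rhoE SubK.
Qed.

(** * Integer powers *)

Section IntegerPowers.
Variable G : groupType.
Implicit Type g : G.

Local Lemma PoszS n : Posz n.+1 = (Posz n + 1)%R.
Proof. by rewrite intS GRing.addrC. Qed.

Definition expgz g (z : int) :=
  match z with Posz n => g ^+ n | Negz n => g ^- n.+1 end.

Lemma expgzS g z : expgz g (z + 1)%R = expgz g z * g.
Proof.
case: z => n; first by rewrite -PoszS /= expgSr.
case: n => [|n]; first by rewrite [LHS]/= expg0 /= expg1 mulVg.
have -> : (Negz n.+1 + 1)%R = Negz n by rewrite !NegzE [in LHS]PoszS
  GRing.opprD GRing.subrK.
by rewrite /= [in RHS]expgS invgM mulgVK.
Qed.

Lemma expgzD g x y : expgz g (x + y)%R = expgz g x * expgz g y.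
Proof.
elim/int_rect: y => [|n IH|n IH]; first by rewrite GRing.addr0 mulg1.
  by rewrite PoszS GRing.addrA !expgzS IH mulgA.
apply: (mulIg g); rewrite -mulgA -!expgzS -GRing.addrA.
have -> : (- Posz n.+1 + 1 = - Posz n)%R by rewrite PoszS GRing.opprD
  GRing.subrK.
exact: IH.
Qed.

Lemma expgzN g x : expgz g (- x)%R = (expgz g x)^-1.
Proof.
by apply: (mulIg (expgz g x)); rewrite -expgzD GRing.addNr mulVg.
Qed.

End IntegerPowers.

(** * An abelian normal subgroup as a module under conjugation *)

Section AdditiveModule.
Variables (G : groupType) (M : normal_subgroup G).
Variable abM : abelian_set (normal_subgroup_set M).

(* The group [M] written additively, so that the theory of [zmodType] applies. *)
Definition addmod of abelian_set (normal_subgroup_set M) : Type :=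
  group_of (Subgroup (normal_subgroupP M).1).
Local Notation V := (addmod abM).

HB.instance Definition _ := Choice.on V.

Let mulV (u v : V) : V := u * v.
Let oneV : V := 1.
Let invV (u : V) : V := u^-1.

Lemma addmodA : associative mulV. Proof. exact: mulgA. Qed.
Lemma addmodC : commutative mulV.
Proof.
move=> u v; apply: val_inj; rewrite [LHS]valM [RHS]valM.
by apply: abM; apply: group_ofP.
Qed.
Lemma addmod0 : left_id oneV mulV. Proof. exact: mul1g. Qed.
Lemma addmodN : left_inverse oneV invV mulV. Proof. exact: mulVg. Qed.

HB.instance Definition _ :=
  GRing.isZmodule.Build V addmodA addmodC addmod0 addmodN.

Definition addval (v : V) : G := val v.

Lemma addval_inj : injective addval. Proof. exact: val_inj. Qed.

Lemma addvalP v : normal_subgroup_set M (addval v).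
Proof. exact: group_ofP. Qed.

Lemma addval_exists x : normal_subgroup_set M x -> exists v, addval v = x.
Proof. by move=> /mem_set Mx;
  exists (Sub x Mx : group_of (Subgroup (normal_subgroupP M).1));
    rewrite /addval SubK. Qed.

Lemma addval0 : addval 0%R = 1. Proof. exact: group_of_val1. Qed.

Lemma addvalD : {morph addval : u v / (u + v)%R >-> u * v}.
Proof. by move=> u v; rewrite /addval [LHS]valM. Qed.

Lemma addvalN : {morph addval : u / (- u)%R >-> u^-1}.
Proof.
by move=> u; apply: (mulIg (addval u)); rewrite -addvalD GRing.addNr.
Qed.

Lemma addvalB : {morph addval : u v / (u - v)%R >-> u / v}.
Proof. by move=> u v; rewrite addvalD addvalN. Qed.

Lemma addvalMn u n : addval (u *+ n)%R = addval u ^+ n.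
Proof.
elim: n => [|n IH]; first by rewrite GRing.mulr0n addval0.
by rewrite GRing.mulrS addvalD IH expgS.
Qed.

(** [insubd] asks for a default, here [v]; as [M] is normal, the conjugate always lies in the
    carrier. *)
Definition conj_act (g : G) (v : V) : V := insubd v (addval v ^ g).

Lemma addval_conj g v : addval (conj_act g v) = addval v ^ g.
Proof.
rewrite /addval /conj_act val_insubd ifT //.
by apply/mem_set/normal_subgroupJ/addvalP.
Qed.

Lemma conj_actB g : {morph conj_act g : u v / (u - v)%R}.
Proof.
by move=> u v; apply: addval_inj;
  rewrite addvalB !addval_conj addvalB conjMg conjVg.
Qed.

Lemma conj_act1 v : conj_act 1 v = v.
Proof. by apply: addval_inj; rewrite addval_conj conjg1. Qed.

Lemma conj_actM g h v : conj_act (g * h) v = conj_act h (conj_act g v).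
Proof. by apply: addval_inj; rewrite !addval_conj conjgM. Qed.

Lemma conj_act_id g v : normal_subgroup_set M g -> conj_act g v = v.
Proof.
move=> Mg; apply: addval_inj; rewrite addval_conj.
by apply/conjg_fixP/commgP/abM => //; apply: addvalP.
Qed.

(** * A free orbit yields an embedded wreath product *)

Section Wreath.
Variables (g : G) (a : V).
Local Open Scope ring_scope.
Hypothesis free : forall (d : nat) (c : nat -> int),
  \sum_(i < d) conj_act (g ^+ i)%g a *~ c i = 0 -> forall i,
    (i < d)%N -> c i = 0.

Let term (f : int -> int) (x : int) : V := conj_act (expgz g x) a *~ f x.
Let Phi (f : int -> int) : V := \sum_(x \in setT) term f x.
Let supp (f : int -> int) := [set x | f x <> 0].

Lemma conj_actMz h (v : V) c : conj_act h (v *~ c) = conj_act h v *~ c.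
Proof. exact: (actMz conj_actB). Qed.

Lemma PhiE f (D : set int) : supp f `<=` D -> Phi f = \sum_(x \in D) term f x.
Proof.
move=> fD; apply/esym/fsbig_widen => // x [_ nDx].
apply/eqP; rewrite /term; have [->|/eqP fx] := eqVneq (f x) 0;
  first by rewrite mulr0z.
by case: nDx; apply: fD.
Qed.

Lemma PhiD f1 f2 : finite_set (supp f1) -> finite_set (supp f2) ->
  Phi (fun x => f1 x + f2 x) = Phi f1 + Phi f2.
Proof.
move=> fin1 fin2; pose D := supp f1 `|` supp f2.
rewrite (@PhiE _ D) ?(@PhiE f1 D) ?(@PhiE f2 D) //.
- rewrite -fsbig_split ?finite_setU //=.
  by apply: eq_fsbigr => x _; rewrite /term mulrzDr_tmp.
- by move=> x; right.
- by move=> x; left.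
move=> x; rewrite /supp /=; have [->|/eqP] := eqVneq (f1 x) 0; last by left.
by rewrite add0r; right.
Qed.

Lemma Phi_shift f b : finite_set (supp f) ->
  Phi (fun x => f (x - b)) = conj_act (expgz g b) (Phi f).
Proof.
move=> finf; rewrite {1}/Phi (reindex_fsbigT (fun x => x + b)); last first.
  by exists (fun x => x - b) => x; rewrite ?addrK ?subrK.
rewrite (@PhiE f (supp f)) // [X in conj_act _ X]fsbig_finite //.
rewrite (act_sum conj_actB) -fsbig_finite //=.
rewrite (fsbig_widen (supp f) setT) //; last first.
  move=> x [_ /contrapT fx]; apply/eqP.
  by rewrite /term fx mulr0z (act0 conj_actB).
apply: eq_fsbigr => x _.
by rewrite /term addrK conj_actMz expgzD conj_actM.
Qed.


(** [free] concerns natural exponents only, so the support, bounded by [N] in absolute value, is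
    first shifted into the range from 0 to [2N]. *)
Lemma Phi0 f : finite_set (supp f) -> Phi f = 0 -> forall x, f x = 0.
Proof.
move=> finf f0 x; have [N suppN] : exists N : nat, forall y,
  supp f y -> `|y| <= N%:Z.
  exists (\sum_(y <- fset_set (supp f)) absz y)%N => y fy.
  rewrite -abszE lez_nat (big_rem y) /= ?leq_addr //.
  by rewrite in_fset_set // mem_set.
have [-> //|/eqP fx] := eqVneq (f x) 0.
pose c (i : nat) := f (i%:Z - N%:Z).
have shiftE i : (i < (N + N).+1)%N -> c i = 0.
  apply: free => {i}; rewrite (fsbig_ord _ _ (fun i =>
    conj_act (g ^+ i)%g a *~ c i)).
  transitivity (Phi (fun x => f (x - N%:Z))); last first.
    by rewrite Phi_shift // f0 (act0 conj_actB).
  rewrite (@PhiE _ [set i%:Z | i in `I_(N + N).+1]).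
    by rewrite fsbig_image => [|i j _ _ []//]; apply: eq_fsbigr.
  move=> y; rewrite /supp /= => /suppN; rewrite ler_norml => /andP[].
  rewrite lerBrDr addrC subrr => y0; rewrite lerBlDr => yN.
  exists (absz y); last by rewrite gez0_abs.
  by rewrite /= ltnS -lez_nat gez0_abs // PoszD.
have := suppN x fx; rewrite ler_norml => /andP[xN Nx].
have := shiftE (absz (x + N%:Z)).
have xN0 : 0 <= x + N%:Z by rewrite -lerBlDr sub0r.
rewrite /c gez0_abs // addrK; apply.
by rewrite ltnS -lez_nat gez0_abs // PoszD lerD2r.
Qed.

(** A positive power of [g] lying in [M] fixes [a], which is a nontrivial relation with coefficients
    -1 and 1. *)
Lemma expgz_free b : normal_subgroup_set M (expgz g b) -> b = 0.
Proof.
have nat_case n : normal_subgroup_set M (g ^+ n.+1)%g -> False.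
  move=> /conj_act_id fix_a.
  pose c (i : nat) : int := if i == 0%N then -1 else if i == n.+1 then 1 else 0.
  have : c 0%N = 0; last by [].
  have cn : c n.+1 = 1 by rewrite /c eqxx.
  have ci i : (i < n)%N -> c i.+1 = 0 by rewrite /c eqSS => /ltn_eqF ->.
  apply: (free (d := n.+2)) => //; rewrite big_ord_recl big_ord_recr /=.
  rewrite big1 => [|i _]; last by rewrite /bump /= add1n ci ?mulr0z.
  rewrite /bump add1n cn fix_a expg0 conj_act1 add0r.
  by rewrite [c _]/= mulrN1z mulr1z addNr.
case: b => [[//|n] /nat_case //|n].
by move=> /(subgroupV (normal_subgroupP M).1); rewrite /= invgK => /nat_case.
Qed.

(** The power of [g] is inverted because conjugation acts on the right, whereas the wreath product
    lets its top group act on the left. *)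
Definition wreath_map (w : Z_wr_Z) : G :=
  (addval (Phi (val w).1) / expgz g (val w).2)%g.

Lemma wreath_support (w : Z_wr_Z) : finite_set (supp (val w).1).
Proof.
exact: (@group_ofP _ (Subgroup (@finite_support_subgroup Zgroup Zgroup)) w).
Qed.

Lemma wreath_mapM : {morph wreath_map : u v / (u * v)%g}.
Proof.
move=> u v; have fu := wreath_support u; have fv := wreath_support v.
rewrite /wreath_map valM;
  move: (val u) (val v) fu fv => [f1 b1] [f2 b2] fin1 fin2.
have -> : Phi (((f1, b1) : full_wreath Zgroup Zgroup) * (f2, b2))%g.1 =
    Phi f1 + conj_act (expgz g b1) (Phi f2).
  rewrite -Phi_shift // -PhiD //.
    by congr Phi; apply/funext => x; congr (_ + f2 _); rewrite [LHS]addrC.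
  apply: (@sub_finite_set _ _ [set x + b1 | x in supp f2]).
    by move=> x fx; exists (x - b1); rewrite ?subrK.
  exact: finite_image.
have -> : expgz g (((f1, b1) : full_wreath Zgroup Zgroup) * (f2, b2))%g.2 =
   (expgz g b2 * expgz g b1)%g by rewrite -expgzD addrC.
rewrite addvalD addval_conj /= invgM conjgE.
by rewrite !mulgA mulgK.
Qed.

Lemma wreath_map_inj : injective wreath_map.
Proof.
have map1 : wreath_map 1%g = 1%g.
  by apply: (mulgI (wreath_map 1%g)); rewrite -wreath_mapM !mulg1.
move=> u v uv; apply/divg1_eq; set w := (u / v)%g.
have : wreath_map w = 1%g.
  by apply: (mulIg (wreath_map v)); rewrite -wreath_mapM mulgVK mul1g.
have := wreath_support w; rewrite /wreath_map.
case wE: (val w) => [f b] /= finf /divg1_eq fb.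
have b0 : b = 0 by apply: expgz_free; rewrite -fb; apply: addvalP.
have f0 : Phi f = 0 by apply: addval_inj; rewrite fb b0 addval0.
apply: val_inj; rewrite wE group_of_val1 b0; congr pair.
by apply/funext => x; apply: Phi0.
Qed.

End Wreath.

Lemma dependent_orbit g (a : V) : ~ has_section G Z_wr_Z ->
  exists (d : nat) (c : nat -> int), (exists2 i, (i < d)%N & c i != 0%R) /\
    (\sum_(i < d) conj_act (g ^+ i)%g a *~ c i = 0)%R.
Proof.
move=> nosec; apply: contrapT => /forallNP nrel; apply: nosec.
have free (d : nat) (c : nat -> int) :
    (\sum_(i < d) conj_act (g ^+ i)%g a *~ c i = 0)%R ->
    forall i, (i < d)%N -> c i = 0%R.
  move=> rel i id; apply: contrapT => /eqP ci; apply: (nrel d); exists c.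
  by split=> //; exists i.
apply: (injective_has_section (theta := wreath_map g a)).
  exact: wreath_mapM.
exact: wreath_map_inj.
Qed.

End AdditiveModule.

(** * Groups with Krull dimension *)

Section AbelianByAbelian.
Variables (G : groupType) (M : normal_subgroup G).
Hypothesis abM : abelian_set (normal_subgroup_set M).
Hypothesis commM : forall x y : G, normal_subgroup_set M [~ x, y].
Local Notation V := (addmod abM).
Local Notation addval := (@addval G M abM).
Implicit Types (x y g : G) (v : V) (H : set G).

Let sM : is_subgroup (normal_subgroup_set M) := (normal_subgroupP M).1.

(** The two products of [g] and [h] differ by a commutator, which lies in the abelian [M] and so
    acts trivially. *)
Lemma conj_actC g h v : conj_act g (conj_act h v) = conj_act h (conj_act g v).
Proof. by rewrite -!conj_actM [h * g]commgC conj_actM conj_act_id. Qed.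

Lemma image_addval_subgroup (U : set V) : zsub U -> is_subgroup (addval @` U).
Proof.
move=> [U0 UB]; split; first by exists 0%R => //; rewrite addval0.
by move=> _ _ [u Uu <-] [v Uv <-]; exists (u - v)%R; rewrite ?addvalB //;
  apply: UB.
Qed.

Lemma image_addval_conj (U : set V) x y :
  (addval @` U) x -> normal_subgroup_set M y -> (addval @` U) (x ^ y).
Proof.
by move=> [u Uu <-] My; exists u; rewrite // -addval_conj conj_act_id.
Qed.

Lemma preimage_addval_zsub H : is_subgroup H -> zsub (addval @^-1` H).
Proof.
move=> sH; split; first by rewrite /= addval0; case: sH.
by move=> u v Hu Hv; rewrite /preimage /= addvalB; apply: sH.2.
Qed.

Lemma series_zspan (S : seq V) : series (addval @` zspan S).
Proof.
elim: S => [|s S IH] /=.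
  by rewrite image_set1 addval0; apply: series1.
have zS := zspan_zsub (s :: S).
apply: (seriesS IH).
- exact: image_addval_subgroup.
- by move=> _ [u Su <-]; exists u => //; exists 0%R; rewrite mulr0z GRing.subr0.
- by move=> x y Sx [v _ <-]; apply: image_addval_conj (addvalP v).
right; exists (addval s); first by exists s => //; exists 1%R;
  rewrite mulr1z GRing.subrr; case: (zspan_zsub S).
move=> _ [v [[n|n] Sv] <-].
  by exists n; right; exists (v - s *~ Posz n)%R;
    rewrite // addvalB -pmulrn addvalMn.
exists n.+1; left; exists (v - s *~ Negz n)%R => //.
by rewrite NegzE mulrNz GRing.opprK -pmulrn addvalD addvalMn.
Qed.

Hypothesis tfM : forall x n,
  normal_subgroup_set M x -> (0 < n)%N -> x ^+ n = 1 -> x = 1.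

Lemma addval_torsion_free v n : (0 < n)%N -> (v *+ n = 0)%R -> v = 0%R.
Proof.
move=> n0 vn0; apply: addval_inj; rewrite addval0; apply: (tfM _ n0);
  first exact: addvalP.
by rewrite -addvalMn vn0 addval0.
Qed.

Lemma series_module (S : seq V) m : (0 < m)%N ->
  (forall v, exists k, zspan S (v *+ m ^ k)%R) -> series (normal_subgroup_set
    M).
Proof.
move=> m0 tors; apply: (seriesS (series_zspan S)) => //.
- by move=> _ [v _ <-]; apply: addvalP.
- by move=> x y Sx My; apply: image_addval_conj.
left=> C [U0 CU0] CI.
have [||_ [U CU <-] Umin] := min_condition_power_torsion addval_torsion_free m0
  tors
    (C := [set addval @^-1` U | U in C]).
- by exists (addval @^-1` U0), U0.
- move=> _ [U /CI[sU SU _] <-]; split; first exact: preimage_addval_zsub.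
  by move=> v Sv; apply: SU; exists v.
exists U => // W CW WU x Ux; have [_ _ UM] := CI _ CU.
have [v xE] := addval_exists abM (UM x Ux); rewrite -xE.
apply: (Umin (addval @^-1` W)); first by exists W.
  by move=> u /= /WU.
by rewrite /= xE.
Qed.

Lemma conj_over_module H x y : is_subgroup H -> normal_subgroup_set M `<=` H ->
  H x -> H (x ^ y).
Proof.
move=> sH MH Hx; rewrite -(mulVKg x (x ^ y)) -commgEl.
by apply: subgroupM => //; apply: MH.
Qed.

Lemma series_over_module (gs : seq G) : series (normal_subgroup_set M) ->
  exists H, [/\ series H, normal_subgroup_set M `<=` H & forall g,
    g \in gs -> H g].
Proof.
move=> serM; elim: gs => [|g gs [H [serH MH gsH]]].
  by exists (normal_subgroup_set M); split.
have sH := series_subgroup serH.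
pose H' := [set x | exists z, H (x * expgz g z)].
have HH' : H `<=` H' by move=> x Hx; exists 0%R; rewrite /= mulg1.
have H'g : H' g by exists (- 1)%R; rewrite expgzN /= mulgV; case: sH.
exists H'; split.
- apply: (seriesS serH) => //.
  + split=> [|x y [z Hx] [w Hy]]; first by apply: HH'; case: sH.
    (* Reordering the powers of [g] past [y^-1] costs one commutator, which lies in [M] and hence in
       [H]. *)
    exists (z - w)%R; apply: (@subgroupMr _ _ _ [~ expgz g (z - w)%R, y^-1] sH).
      exact: MH.
    have -> : x / y * expgz g (z - w)%R * [~ expgz g (z - w)%R, y^-1] =
        x * expgz g z / (y * expgz g w).
      by rewrite -!mulgA [y^-1 * _]mulgA -commgC expgzD expgzN invgM !mulgA.
    exact: sH.2.
  + by move=> x y Hx _; apply: conj_over_module.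
  right; exists g => // x [[n|n] Hx]; first by exists n; left.
  by exists n.+1; right.
- by move=> x /MH/HH'.
by move=> h; rewrite inE => /predU1P[->//|/gsH/HH'].
Qed.

Variable gs : seq G.
Hypothesis genG : forall H, is_subgroup H -> normal_subgroup_set M `<=` H ->
  (forall g, g \in gs -> H g) -> H = [set: G].

(** The [g] for which both [g] and [g^-1] preserve [U] form a subgroup containing [M] and [gs],
    hence all of [G]. The inverses are listed because stability under [g] alone does not give
    stability under [g^-1]. *)
Lemma submodule_normal (U : set V) :
  submodule (@conj_act G M abM) (gs ++ [seq g^-1 | g <- gs]) U ->
  is_normal_subgroup (addval @` U).
Proof.
move=> [zU stU]; split; first exact: image_addval_subgroup.
pose H := [set g | forall v, U v -> U (conj_act g v) /\ U (conj_act g^-1 v)].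
have HT : H = [set: G].
  apply: genG.
  - split=> [v Uv|x y Hx Hy v Uv]; first by rewrite invg1 conj_act1.
    rewrite invgM invgK !conj_actM; split; first exact: (Hy _ (Hx v Uv).1).2.
    exact: (Hx _ (Hy v Uv).1).2.
  - by move=> x Mx v Uv; rewrite !conj_act_id //; apply: subgroupV.
  move=> g ggs v Uv; split; apply: stU => //;
    rewrite mem_cat ?ggs // map_f ?orbT //.
move=> _ y [v Uv <-]; rewrite -addval_conj; exists (conj_act y v) => //.
by have /(_ v Uv)[] : H y by rewrite HT.
Qed.

Theorem series_of_krull : has_krull_dimension G -> ~ has_section G Z_wr_Z ->
  series [set: G].
Proof.
move=> krullG nosec; pose gs' := gs ++ [seq g^-1 | g <- gs].
have [|||||L x subL Lx nLx|S [m [m0 tors]]] :=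
  @finite_rank_power G V (@conj_act G M abM) gs'.
- exact: conj_actB.
- exact: conj_act1.
- exact: conj_actM.
- exact: conj_actC.
- by move=> g a; apply: dependent_orbit.
- apply: (krull_dimension_no_coindependent (L := fun k => addval @` L k)
    (x := addval \o x) krullG) => [k|i k ik|k [v Lv /addval_inj vx]].
  + exact: submodule_normal.
  + by exists (x k) => //; apply: Lx.
  + by apply: (nLx k); rewrite -vx.
have [H [serH MH gsH]] := series_over_module gs (series_module m0 tors).
by rewrite -(genG (series_subgroup serH) MH gsH).
Qed.

End AbelianByAbelian.

(** * Passage to the quotient by the torsion subgroup *)

Section TorsionQuotientGroup.
Variables (G : groupType) (A : normal_subgroup G).
Hypothesis abA : abelian_set A.
Let T := torsion_subgroup abA.
Local Notation p := (quotient_proj T).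

Lemma image_normal : is_normal_subgroup (p @` normal_subgroup_set A).
Proof.
have [[A1 AF] AJ] := normal_subgroupP A.
split; first split.
- by exists 1.
- by move=> _ _ [x Ax <-] [y Ay <-]; exists (x / y);
  [apply: AF | rewrite gmulfF].
move=> _ q [x Ax <-]; have [y ->] := quotient_projP q.
by exists (x ^ y); [apply: AJ | rewrite gmulfJ].
Qed.

Definition image_subgroup := NormalSubgroup image_normal.

Lemma image_abelian : abelian_set (normal_subgroup_set image_subgroup).
Proof.
by move=> _ _ [x Ax <-] [y Ay <-]; rewrite /commute -!gmulfM abA.
Qed.

Lemma image_torsion_free q n : normal_subgroup_set image_subgroup q ->
  (0 < n)%N -> q ^+ n = 1 -> q = 1.
Proof.
move=> [x Ax <-] n0; rewrite -gmulfXn => /esym/quotient_eqP.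
rewrite invg1 mul1g => -[_ [m m0 xnm]]; apply/esym/quotient_eqP.
rewrite invg1 mul1g; split=> //; exists (n * m)%N; first by rewrite muln_gt0 n0.
by rewrite expgnA.
Qed.

Lemma image_commutator : abelian_group (quotient_group A) ->
  forall q r, normal_subgroup_set image_subgroup [~ q, r].
Proof.
move=> abB q r; have [x ->] := quotient_projP q;
  have [y ->] := quotient_projP r.
exists [~ x, y]; last by rewrite gmulfR.
suff /esym/quotient_eqP : quotient_proj A [~ x, y] = 1 by rewrite invg1 mul1g.
by rewrite gmulfR; apply/eqP/commgP/abB.
Qed.

(** Generators of [G / A] are lifted. Since [H] contains the image of [A], membership of a lift in
    [H] depends only on its class modulo [A], so these classes form a subgroup [K], which contains
    the generators. *)
Lemma image_generators : finitely_generated (quotient_group A) ->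
  exists gs : seq (quotient_group T), forall H, is_subgroup H ->
    normal_subgroup_set image_subgroup `<=` H -> (forall g, g \in gs -> H g) ->
    H = [set: quotient_group T].
Proof.
move=> [s sT]; exists [seq p (repr c) | c <- s] => H sH AH gsH.
pose K := [set c | forall x, quotient_proj A x = c -> H (p x)].
have cosetH x y : quotient_proj A x = quotient_proj A y -> H (p x) -> H (p y).
  move=> /quotient_eqP Axy Hx; rewrite -(mulVKg x y) gmulfM;
    apply: subgroupM => //.
  by apply: AH; exists (x^-1 * y).
have KT : generated [set x | x \in s] `<=` K.
  apply: smallest_sub.
    split=> [x x1|c c' Kc Kc' x].
      by apply: (cosetH 1); [rewrite x1 | case: sH].
    have [y cE] := quotient_projP c; have [z c'E] := quotient_projP c'.
    move=> xE; apply: (cosetH (y / z)); first by rewrite xE cE c'E gmulfF.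
    by rewrite gmulfF; apply: sH.2; [apply: Kc | apply: Kc'].
  move=> c cs x xc; apply: (cosetH (repr c));
    first by rewrite xc /quotient_proj reprK.
  by apply: gsH; apply: map_f.
rewrite eqEsubset; split=> // q _; have [x ->] := quotient_projP q.
by apply: (KT (quotient_proj A x)) => //; rewrite sT.
Qed.

End TorsionQuotientGroup.

Theorem proposition3p3 (G : groupType) (metG : metabelian G)
    (A : normal_subgroup G) (abA : abelian_set A)
    (fgB : finitely_generated (quotient_group A))
    (abB : abelian_group (quotient_group A))
    (krullG : has_krull_dimension (quotient_group (torsion_subgroup abA)))
    (nosec : ~ has_section (quotient_group (torsion_subgroup abA)) Z_wr_Z) :
  minimax (quotient_group (torsion_subgroup abA)) /\
  krull_dimension_le (quotient_group (torsion_subgroup abA)) (Dord Oone).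
Proof.
have [gs genG] := image_generators abA fgB.
have ser : series [set: quotient_group (torsion_subgroup abA)].
  apply: (series_of_krull (image_abelian (abA := abA)) _ _ genG krullG nosec).
    exact: image_commutator.
  exact: image_torsion_free.
by split; [apply: series_minimax | apply: series_krull].
Qed.
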